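(* If $\mathfrak{g}$ is a complex simple Lie algebra of type $\mathrm{E}_6$ and $\pi'=\{\alpha_1,\alpha_2,\alpha_3,\alpha_4,\alpha_6\}$, then the standard parabolic subalgebra $\mathfrak{p}_{\pi'}^+$ is not quasi-reductive.
   Context: Quasi-reductivity. Let $\mathfrak{a}$ be the Lie algebra of a complex connected linear algebraic group $A$ with center $Z$, and let $\mathfrak{z}$ be the center of $\mathfrak{a}$. For $f\in\mathfrak{a}^*$ let $A(f)$ be its stabilizer under the coadjoint action and $\mathfrak{a}(f)=\{x\in\mathfrak{a} : f([x,y])=0\ \forall y\in\mathfrak{a}\}$ the Lie algebra of $A(f)$. The form $f$ is of reductive type if $A(f)/Z$ is a reductive subgroup of $\mathrm{GL}(\mathfrak{a})$; equivalently, if $\mathfrak{a}(f)/\mathfrak{z}$ is a reductive Lie algebra whose center consists of semisimple elements. $\mathfrak{a}$ is quasi-reductive if it has a linear form of reductive type. Subalgebras of $\mathfrak{g}$ considered here are Lie algebras of connected closed subgroups of a connected algebraic group with Lie algebra $\mathfrak{g}$. Standard parabolics. Fix a triangular decomposition $\mathfrak{g}=\mathfrak{n}^+\oplus\mathfrak{h}\oplus\mathfrak{n}^-$ with simple roots $\pi$. For $\pi'\subset\pi$, $\mathfrak{p}_{\pi'}^+$ is the subalgebra generated by $\mathfrak{h}\oplus\mathfrak{n}^+$ and the root spaces $\mathfrak{g}_{-\alpha}$, $\alpha\in\pi'$. Labelling of $\mathrm{E}_6$ (Bourbaki): chain $\alpha_1-\alpha_3-\alpha_4-\alpha_5-\alpha_6$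 with $\alpha_2$ attached to $\alpha_4$. *)

(* Defs.v *)
From HB Require Import structures.
From mathcomp Require Import all_boot all_order all_algebra.

Set Implicit Arguments.
Unset Strict Implicit.
Unset Printing Implicit Defensive.

Import GRing.Theory.
Local Open Scope ring_scope.

HB.mixin Record Vector_isLieAlgebra (K : fieldType) L of Vector K L := {
  lie : L -> L -> L;
  lie_linearl : forall (k : K) (x y z : L),
    lie (k *: x + y) z = k *: lie x z + lie y z;
  lie_linearr : forall (k : K) (x y z : L),
    lie x (k *: y + z) = k *: lie x y + lie x z;
  liexx : forall x : L, lie x x = 0;
  lie_jacobi : forall x y z : L,
    lie x (lie y z) + lie y (lie z x) + lie z (lie x y) = 0
}.

#[short(type="lieAlgType")]
HB.structure Definition LieAlgebra (K : fieldType) :=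
  { L of Vector_isLieAlgebra K L & Vector K L }.

Section GlLie.
Variables (K : fieldType) (V : vectType K).
Implicit Types f g h : 'End(V).

Definition gl_lie f g : 'End(V) := (f \o g)%VF - (g \o f)%VF.

Fact gl_lieE f g v : gl_lie f g v = f (g v) - g (f v).
Proof. by rewrite /gl_lie add_lfunE opp_lfunE !comp_lfunE. Qed.

Fact gl_lie_linearl (k : K) f g h :
  gl_lie (k *: f + g) h = k *: gl_lie f h + gl_lie g h.
Proof.
apply/lfunP => v; rewrite gl_lieE [RHS]add_lfunE [in RHS]scale_lfunE !gl_lieE.
by rewrite !add_lfunE !scale_lfunE linearD linearZ scalerBr opprD addrACA.
Qed.

Fact gl_lie_linearr (k : K) f g h :
  gl_lie f (k *: g + h) = k *: gl_lie f g + gl_lie f h.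
Proof.
apply/lfunP => v; rewrite gl_lieE [RHS]add_lfunE [in RHS]scale_lfunE !gl_lieE.
by rewrite !add_lfunE !scale_lfunE linearD linearZ scalerBr opprD addrACA.
Qed.

Fact gl_liexx f : gl_lie f f = 0.
Proof. exact: subrr. Qed.

Fact gl_lie_jacobi f g h :
  gl_lie f (gl_lie g h) + gl_lie g (gl_lie h f) + gl_lie h (gl_lie f g) = 0.
Proof.
apply/lfunP => v; rewrite zero_lfunE [LHS]add_lfunE [X in X + _]add_lfunE.
rewrite !gl_lieE !linearB /= !opprK !addrA.
rewrite [LHS](ACl ((1*11)*(8*2)*(5*3)*(4*10)*(12*6)*(9*7)))/=.
by rewrite !subrr !addr0.
Qed.

HB.instance Definition _ := Vector_isLieAlgebra.Build K 'End(V)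
  gl_lie_linearl gl_lie_linearr gl_liexx gl_lie_jacobi.

End GlLie.

Section Subspaces.
Variables (K : fieldType) (L : lieAlgType K).
Implicit Types (x y : L) (U W I : {vspace L}).

Fact lie_is_linear x : linear (lie x).
Proof. by move=> k y z; rewrite lie_linearr. Qed.
HB.instance Definition _ x :=
  GRing.isLinear.Build K L L *:%R (lie x) (lie_is_linear x).

Definition ad1 x : 'End(L) := linfun (lie x).

Lemma ad1E x y : ad1 x y = lie x y.
Proof. by rewrite lfunE. Qed.

Fact ad1_is_linear : linear ad1.
Proof.
by move=> k x y; apply/lfunP => z; rewrite add_lfunE scale_lfunE !ad1E lie_linearl.
Qed.
HB.instance Definition _ :=
  GRing.isLinear.Build K L 'End(L) *:%R ad1 ad1_is_linear.

Definition ad : 'Hom(L, 'End(L)) := linfun ad1.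

Lemma adE x y : ad x y = lie x y.
Proof. by rewrite lfunE /= ad1E. Qed.

Definition lie_prod U W : {vspace L} :=
  <<[seq lie x y | x <- vbasis U, y <- vbasis W]>>%VS.

Lemma lie_prod_subP U W I :
  reflect (forall x y, x \in U -> y \in W -> lie x y \in I)
          (lie_prod U W <= I)%VS.
Proof.
apply: (iffP span_subvP) => [UWI x y xU yW | UWI _ /allpairsP[[x y] [/= xU yW ->]]];
  last by apply: UWI; exact: vbasis_mem.
rewrite -adE (coord_vbasis xU) linear_sum sum_lfunE memv_suml // => i _.
rewrite linearZ scale_lfunE memvZ // adE (coord_vbasis yW) linear_sum.
rewrite memv_suml // => j _; rewrite linearZ memvZ // UWI //.
by apply/allpairsP; exists ((vbasis U)`_i, (vbasis W)`_j); rewrite !mem_nth ?size_tuple.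
Qed.

Definition is_subalgebra U := forall x y, x \in U -> y \in U -> lie x y \in U.

Definition is_ideal U I :=
  (I <= U)%VS /\ forall x y, x \in U -> y \in I -> lie x y \in I.

Definition derived_series U n := iter n (fun W => lie_prod W W) U.
Definition lower_central_series U n := iter n (lie_prod U) U.

Definition solvable U := exists n, derived_series U n = 0%VS.
Definition nilpotent U := exists n, lower_central_series U n = 0%VS.

Definition center U : {vspace L} :=
  (U :&: \bigcap_(i < \dim U) lker (ad (vbasis U)`_i))%VS.

Lemma centerP U x :
  reflect (x \in U /\ forall y, y \in U -> lie y x = 0) (x \in center U).
Proof.
rewrite memv_cap; apply: (iffP andP) => -[xU xZ]; split=> //.
  move=> y yU; rewrite -adE (coord_vbasis yU) linear_sum sum_lfunE big1 // => i _.
  rewrite linearZ scale_lfunE; move: xZ; rewrite memvE => /subv_bigcapP/(_ i isT).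
  by rewrite -memvE memv_ker => /eqP ->; rewrite scaler0.
rewrite memvE; apply/subv_bigcapP => i _; rewrite -memvE memv_ker adE xZ //.
by rewrite vbasis_mem // mem_nth ?size_tuple.
Qed.

Definition is_radical U I :=
  [/\ is_ideal U I, solvable I &
    forall J, is_ideal U J -> solvable J -> (J <= I)%VS].

Definition reductive U := is_radical U (center U).

Definition simple :=
  (exists x y, lie x y != 0) /\
  forall I, is_ideal fullv I -> I = 0%VS \/ I = fullv.

(** The subalgebra generated by U: the increasing iteration is stationary after at
    most [\dim L] steps. *)
Definition lie_gen U : {vspace L} :=
  iter (\dim {:L}) (fun W => W + lie_prod W W)%VS U.

Lemma lie_gen_subv U : (U <= lie_gen U)%VS.
Proof.
rewrite /lie_gen; elim: (\dim _) => //= n IHn.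
by apply: subv_trans IHn _; exact: addvSl.
Qed.

Lemma lie_gen_min U W : is_subalgebra W -> (U <= W)%VS -> (lie_gen U <= W)%VS.
Proof.
move=> Wsub UW; rewrite /lie_gen; elim: (\dim _) => //= n IHn.
rewrite subv_add IHn; apply/lie_prod_subP => x y /(subvP IHn) xW /(subvP IHn).
exact: Wsub.
Qed.

Lemma lie_gen_is_subalgebra U : is_subalgebra (lie_gen U).
Proof.
pose F W := (W + lie_prod W W)%VS.
have FS W : (W <= F W)%VS by exact: addvSl.
suff fixF : F (lie_gen U) = lie_gen U.
  move=> x y xG yG; rewrite -fixF; apply: (subvP (addvSr _ _)).
  by apply: (lie_prod_subP _ _ _ (subvv _)).
have [n [n_le]] : exists n, (n <= \dim {:L})%N /\ F (iter n F U) = iter n F U.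
  have H m : (exists n, (n <= m)%N /\ F (iter n F U) = iter n F U) \/
             (m < \dim (iter m.+1 F U))%N.
    elim: m => [|m [[n [nm fixn]]|ltm]].
    - have [e|ne] := eqVneq (F U) U; first by left; exists 0%N.
      right; rewrite lt0n dimv_eq0; apply: contraNneq ne => /= F0.
      by rewrite F0; have := FS U; rewrite F0 subv0 eq_sym.
    - by left; exists n; split=> //; exact: leqW.
    - have [e|ne] := eqVneq (F (iter m.+1 F U)) (iter m.+1 F U).
        by left; exists m.+1.
      right; apply: leq_ltn_trans ltm _; rewrite ltn_neqAle dimvS ?FS // andbT.
      by rewrite (dimv_leqif_eq (FS _)) eq_sym.
  by case: (H (\dim {:L})) => //; rewrite ltnNge dimvS ?subvf.
rewrite /lie_gen -/F => fixn; rewrite -(subnK n_le) iterD.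
by elim: (_ - n)%N => //= k IHk; rewrite !IHk.
Qed.

End Subspaces.

Arguments ad {K L}.

Record subalgebra (K : fieldType) (L : lieAlgType K) := Subalgebra {
  subalg_space :> {vspace L};
  subalgP : is_subalgebra subalg_space
}.

Definition subalg_type (K : fieldType) (L : lieAlgType K) (S : subalgebra L) :=
  subvs_of S.
HB.instance Definition _ (K : fieldType) (L : lieAlgType K) (S : subalgebra L) :=
  Vector.copy (subalg_type S) (subvs_of S).

Section SubLie.
Variables (K : fieldType) (L : lieAlgType K) (S : subalgebra L).
Implicit Types x y z : subvs_of S.

Definition sub_lie x y : subvs_of S := Subvs (subalgP (subvsP x) (subvsP y)).

Fact sub_lie_linearl (k : K) x y z :
  sub_lie (k *: x + y) z = k *: sub_lie x z + sub_lie y z.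
Proof. by apply/val_inj; rewrite /= lie_linearl. Qed.

Fact sub_lie_linearr (k : K) x y z :
  sub_lie x (k *: y + z) = k *: sub_lie x y + sub_lie x z.
Proof. by apply/val_inj; rewrite /= lie_linearr. Qed.

Fact sub_liexx x : sub_lie x x = 0.
Proof. by apply/val_inj; rewrite /= liexx. Qed.

Fact sub_lie_jacobi x y z :
  sub_lie x (sub_lie y z) + sub_lie y (sub_lie z x) + sub_lie z (sub_lie x y)
  = 0.
Proof. by apply/val_inj; rewrite /= lie_jacobi. Qed.

HB.instance Definition _ := Vector_isLieAlgebra.Build K (subalg_type S)
  sub_lie_linearl sub_lie_linearr sub_liexx sub_lie_jacobi.

End SubLie.

Section QuasiReductive.
Variables (K : fieldType) (L : lieAlgType K).
Implicit Types (f : 'Hom(L, K^o)) (x y : L).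

Definition coad f x : 'Hom(L, K^o) := (f \o ad x)%VF.

Fact coad_is_linear f : linear (coad f).
Proof.
move=> k x y; apply/lfunP => z; rewrite [RHS]add_lfunE [in RHS]scale_lfunE.
by rewrite !comp_lfunE !adE lie_linearl linearP.
Qed.
HB.instance Definition _ f :=
  GRing.isLinear.Build K L 'Hom(L, K^o) *:%R (coad f) (coad_is_linear f).

(** [L(f) = {x | f([x, y]) = 0 for all y}] *)
Definition stab f : {vspace L} := lker (linfun (coad f)).

Lemma stabP f x : reflect (forall y, f (lie x y) = 0) (x \in stab f).
Proof.
rewrite memv_ker lfunE /=; apply: (iffP eqP) => [fx0 y|fx0].
  by rewrite -adE -comp_lfunE -/(coad f x) fx0 zero_lfunE.
by apply/lfunP => y; rewrite comp_lfunE adE fx0 zero_lfunE.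
Qed.

(** Semisimple = diagonalizable; this is meant for K algebraically closed. *)
Definition semisimple_endo (V : vectType K) (u : 'End(V)) :=
  exists2 b : seq V, basis_of fullv b &
    forall v, v \in b -> exists k : K, u v = k *: v.

(** The kernel of [ad] on L is the center z of L, which is contained in L(f), so
    [ad @: stab f] is L(f)/z, viewed inside gl(L). *)
Definition reductive_type f :=
  let Lf_mod_z := (ad @: stab f)%VS in
  reductive Lf_mod_z /\
  forall u, u \in center Lf_mod_z -> semisimple_endo u.

Definition quasi_reductive := exists f, reductive_type f.

End QuasiReductive.

Arguments quasi_reductive {K} L.
Arguments simple {K} L.

Section Triangular.
Variables (K : fieldType) (L : lieAlgType K).
Implicit Types (h np nm U : {vspace L}).

Definition is_cartan h :=
  [/\ is_subalgebra h, nilpotent h &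
      forall x, (forall y, y \in h -> lie x y \in h) -> x \in h].

Section Roots.
Variable h : {vspace L}.
Implicit Types beta : 'Hom(subvs_of h, K^o).

Definition root_defect beta (x : L) : 'Hom(subvs_of h, L) :=
  linfun (fun t : subvs_of h => lie (vsval t) x - (beta t : K) *: x).

Fact root_defect_fun_linear beta x :
  linear (fun t : subvs_of h => lie (vsval t) x - (beta t : K) *: x).
Proof.
move=> k s t; rewrite !linearP /= lie_linearl scalerBr scalerDl scalerA.
by rewrite opprD addrACA.
Qed.

Lemma root_defectE beta x t :
  root_defect beta x t = lie (vsval t) x - (beta t : K) *: x.
Proof.
pose F := GRing.isLinear.Build K (subvs_of h) L *:%R _
  (root_defect_fun_linear beta x).
pose G : {linear subvs_of h -> L} := HB.pack
  (fun t : subvs_of h => lie (vsval t) x - (beta t : K) *: x) F.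
exact: (lfunE G).
Qed.

Fact root_defect_is_linear beta : linear (root_defect beta).
Proof.
move=> k x y; apply/lfunP => t; rewrite add_lfunE scale_lfunE !root_defectE.
rewrite lie_linearr scalerDr opprD scalerBr !scalerA [k * _]mulrC.
by rewrite addrACA.
Qed.
HB.instance Definition _ beta := GRing.isLinear.Build K L 'Hom(subvs_of h, L)
  *:%R (root_defect beta) (root_defect_is_linear beta).

(** [L_beta = {x | [t, x] = beta(t) x for all t in h}] *)
Definition root_space beta : {vspace L} := lker (linfun (root_defect beta)).

Lemma root_spaceP beta x :
  reflect (forall t : subvs_of h, lie (vsval t) x = (beta t : K) *: x)
          (x \in root_space beta).
Proof.
rewrite memv_ker lfunE /=; apply: (iffP eqP) => [x0 t|x0].
  by apply/eqP; rewrite -subr_eq0 -root_defectE x0 zero_lfunE.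
by apply/lfunP => t; rewrite root_defectE x0 subrr zero_lfunE.
Qed.

Definition is_root beta := beta != 0 /\ root_space beta != 0%VS.

Variables (n : nat) (alpha : 'I_n -> 'Hom(subvs_of h, K^o)).

Definition nat_comb beta :=
  exists c : 'I_n -> nat, beta = \sum_i alpha i *+ c i.

Definition positive_root beta := is_root beta /\ nat_comb beta.
Definition negative_root beta := is_root beta /\ nat_comb (- beta).

Definition is_base :=
  [/\ basis_of fullv [seq alpha i | i : 'I_n],
      forall i, is_root (alpha i) &
      forall beta, is_root beta -> positive_root beta \/ negative_root beta].

Definition is_sum_of_root_spaces (P : 'Hom(subvs_of h, K^o) -> Prop) U :=
  (forall beta, P beta -> (root_space beta <= U)%VS) /\
  (forall W, (forall beta, P beta -> (root_space beta <= W)%VS) -> (U <= W)%VS).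

(** [A i j = alpha_j (alpha_i^vee)], where the coroot [alpha_i^vee] is the element t
    of [[L_(alpha_i), L_(- alpha_i)]] such that [alpha_i t = 2] *)
Definition has_cartan_matrix (A : 'M[int]_n) :=
  forall i, exists t : subvs_of h,
    [/\ vsval t \in lie_prod (root_space (alpha i)) (root_space (- alpha i)),
        alpha i t = 2%:R &
        forall j, alpha j t = (A i j)%:~R].

End Roots.

Definition triangular_decomposition (np h nm : {vspace L}) (n : nat)
    (alpha : 'I_n -> 'Hom(subvs_of h, K^o)) :=
  [/\ is_cartan h, is_base alpha,
      is_sum_of_root_spaces (positive_root alpha) np,
      is_sum_of_root_spaces (negative_root alpha) nm &
      directv (np + h + nm) /\ (np + h + nm)%VS = fullv].

Definition std_parabolic (np h : {vspace L}) (n : nat)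
    (alpha : 'I_n -> 'Hom(subvs_of h, K^o)) (J : {set 'I_n}) : subalgebra L :=
  Subalgebra (@lie_gen_is_subalgebra K L
    (h + np + \sum_(i in J) root_space (- alpha i))%VS).

End Triangular.

(** The simple root with Bourbaki label l in {1, ..., 6} has index l - 1. *)
Definition bourbaki (i : 'I_6) : nat := i.+1.

Definition E6_edge (i j : 'I_6) : bool :=
  (bourbaki i, bourbaki j) \in [:: (1, 3); (3, 4); (4, 5); (5, 6); (2, 4)]%N.

Definition E6_cartan : 'M[int]_6 := \matrix_(i, j)
  if i == j then 2%:Z else if E6_edge i j || E6_edge j i then - 1%:Z else 0.

(* Main.v *)
(** The parabolic is p = (gl(V) x sl(W)) |x (L^2 V (x) W + L^4 V) with dim V = 5 and
    dim W = 2.  For every linear form f on p we exhibit an integer grading of p for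
    which the stabilizer p(f) lies in nonnegative degrees and meets the positive
    degrees nontrivially.  The part of p(f) in positive degrees is then a nilpotent
    ideal; were f of reductive type this ideal would be central, so that its
    elements would be both ad-nilpotent and ad-semisimple, hence zero as p has
    trivial center.

    The grading comes from a flag attached to f.  The restriction of f to L^4 V is a
    vector v_1 of V up to a twist; if it vanishes, L^4 V lies in p(f).  The
    restriction of f to v_1 ^ V (x) W is a map phi from W to (V/v_1)*; if its rank is
    less than 2, then p(f) meets the nilradical.  Otherwise f yields in turn a linear
    form on the image of phi and a vector in a plane, and p(f) contains a nilpotent
    element whether or not these vanish: when they do not, p(f) generically is a line
    of nilpotent elements.  The normalizations of f along this flag are made by
    automorphisms exp(s ad x) with x a root vector, so that everything reduces to
    finite computations with the structure constants of E6.

    These structure constants hold in the given Lie algebra by elementary sl2 theory: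
    a vector killed by f_i on which the coroot t_i acts by a positive integer is zero.
    The same fact bounds the root spaces, descending by simple roots and using that
    the E6 form is positive definite. *)
From HB Require Import structures.
Require Import Defs.
From mathcomp Require Import all_boot all_order all_algebra zify ring.
From mathcomp Require Import complex reals.

Set Implicit Arguments.
Unset Strict Implicit.
Unset Printing Implicit Defensive.

Import Order.TTheory GRing.Theory Num.Theory.
Local Open Scope ring_scope.

(** * Lie algebra preliminaries *)

Section LieTheory.
Variables (K : fieldType) (L : lieAlgType K).
Implicit Types x y z : L.

Lemma lieDl x y z : lie (x + y) z = lie x z + lie y z.
Proof. by rewrite -[x]scale1r lie_linearl !scale1r. Qed.

Lemma lie0l z : lie 0 z = 0.
Proof. by rewrite -adE linear0 zero_lfunE. Qed.

Lemma lieZl k x z : lie (k *: x) z = k *: lie x z.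
Proof. by rewrite -!adE linearZ scale_lfunE. Qed.

Lemma lieNl x z : lie (- x) z = - lie x z.
Proof. by rewrite -scaleN1r lieZl scaleN1r. Qed.

Lemma lie_suml (I : Type) (r : seq I) (P : pred I) (F : I -> L) z :
  lie (\sum_(i <- r | P i) F i) z = \sum_(i <- r | P i) lie (F i) z.
Proof. by rewrite -adE linear_sum sum_lfunE; apply: eq_bigr => i _; rewrite adE. Qed.

Lemma lieC x y : lie x y = - lie y x.
Proof.
apply/eqP; rewrite -addr_eq0; have := liexx (x + y).
by rewrite lieDl !linearD /= !liexx add0r addr0 => ->.
Qed.

Lemma lie_der x y z : lie x (lie y z) = lie (lie x y) z + lie y (lie x z).
Proof.
have /eqP := lie_jacobi x y z.
rewrite [lie z (lie x y)]lieC [lie z x]lieC linearN /=.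
by rewrite -addrA addr_eq0 opprD !opprK addrC => /eqP.
Qed.

End LieTheory.

(** * Eigenvectors for distinct eigenvalues, and free families *)

Section Eigenvectors.
Variables (K : fieldType) (V : lmodType K) (u : {linear V -> V}).

(** Applying [u - lam a] to the sum kills the term of index [a] and multiplies every other term by a
    nonzero scalar, so induction on [s] applies. *)
Lemma eigen_sum0 (I : eqType) (s : seq I) (lam : I -> K) (v : I -> V) :
    uniq s -> {in s &, injective lam} ->
    (forall i, i \in s -> u (v i) = lam i *: v i) ->
    \sum_(i <- s) v i = 0 ->
  forall i, i \in s -> v i = 0.
Proof.
elim: s v => // a s IHs v /= /andP[nas us] inj ev sum0.
have vs0 i : i \in s -> v i = 0.
  move=> si; have nia : lam i - lam a != 0.
    rewrite subr_eq0; apply: contraNneq nas => e.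
    by rewrite -(inj i a (mem_behead (s := a :: s) si) (mem_head _ _) e).
  apply/eqP; rewrite -[_ == 0]orFb -(negPf nia) -scaler_eq0; apply/eqP.
  apply: (IHs (fun i => (lam i - lam a) *: v i)) si => //.
  - by move=> j k sj sk; apply: inj; rewrite inE ?sj ?sk orbT.
  - by move=> j sj /=; rewrite linearZ /= ev ?inE ?sj ?orbT // !scalerA mulrC.
  have: u (\sum_(i <- a :: s) v i) - lam a *: (\sum_(i <- a :: s) v i) = 0.
    by rewrite sum0 linear0 scaler0 subr0.
  rewrite !big_cons linearD ev ?mem_head // scalerDr opprD addrACA subrr add0r.
  rewrite linear_sum scaler_sumr -sumrB => S0; rewrite -[RHS]S0.
  by apply: eq_big_seq => j sj; rewrite ev ?inE ?sj ?orbT // scalerBl.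
move=> i; rewrite inE => /predU1P[-> | /vs0 //].
by move: sum0; rewrite big_cons big_seq big1 ?addr0.
Qed.

End Eigenvectors.

Lemma big_cat3 (V : nmodType) (F : nat -> V) r1 r2 r3 :
  \sum_(i <- r1 ++ r2 ++ r3) F i =
    \sum_(i <- r1) F i + (\sum_(i <- r2) F i + \sum_(i <- r3) F i).
Proof. by rewrite !big_cat. Qed.

Lemma free_mkseqP (K : fieldType) (V : vectType K) (b : nat -> V) n :
  (forall z : nat -> K, \sum_(i < n) z i *: b i = 0 ->
     forall i, (i < n)%N -> z i = 0) -> free (mkseq b n).
Proof.
move=> H; have sz : size (mkseq b n) == n by rewrite size_mkseq.
rewrite -[mkseq b n]/(val (Tuple sz)); apply/freeP => z Hz i.
pose z' k := if insub k is Some j then z j else 0.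
have z'E (j : 'I_n) : z' j = z j by rewrite /z' valK.
rewrite -z'E; apply: H => //; rewrite -[RHS]Hz.
by apply: eq_bigr => j _; rewrite z'E nth_mkseq.
Qed.

Lemma free_mkseq_sum0 (K : fieldType) (V : vectType K) (b : nat -> V) n (z : nat -> K) :
  free (mkseq b n) -> \sum_(i < n) z i *: b i = 0 -> forall i, (i < n)%N -> z i = 0.
Proof.
have sz : size (mkseq b n) == n by rewrite size_mkseq.
rewrite -[mkseq b n]/(val (Tuple sz)) => /freeP H sum0 i lti.
apply: (H (fun j => z j) _ (Ordinal lti)); rewrite -[RHS]sum0.
by apply: eq_bigr => j _; rewrite nth_mkseq.
Qed.

(** * Weight vectors under an sl2-triple *)

Section Sl2.
Variables (K : numFieldType) (L : lieAlgType K).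

(** More than [\dim {:L}] of the [v k] would form a free family. *)
Lemma eigen_chain (u : 'End(L)) (lam : nat -> K) (v : nat -> L) :
  injective lam -> (forall k, u (v k) = lam k *: v k) ->
  ~ (forall k, v k != 0).
Proof.
move=> inj ev nz; have: free (mkseq v (\dim {:L}).+1).
  apply: free_mkseqP => z sum0 i lti.
  have: z i *: v i = 0.
    apply: (@eigen_sum0 _ _ u nat (iota 0 (\dim {:L}).+1) lam
              (fun i => z i *: v i)); rewrite ?iota_uniq ?mem_iota //.
    - by move=> j k _ _; apply: inj.
    - by move=> j _; rewrite linearZ /= ev !scalerA mulrC.
    by move: sum0; rewrite -(big_mkord xpredT (fun i => z i *: v i)) /index_iota subn0.
  by move/eqP; rewrite scaler_eq0 (negPf (nz i)) orbF => /eqP.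
move/eqP=> fr; have := dimvS (subvf <<mkseq v (\dim {:L}).+1>>).
by rewrite fr size_mkseq ltnn.
Qed.

(* A nonzero x would generate an infinite ladder x, [e, x], [e, [e, x]], ...
   since f maps each rung to a nonzero multiple of the previous one. *)
Lemma sl2_positive_weight (e f t x : L) (m : nat) :
    lie e f = t -> lie t e = e *+ 2 -> (0 < m)%N -> lie t x = x *+ m ->
    lie e (lie f x) = 0 ->
  x = 0.
Proof.
move=> ef te m0 tx efx; apply/eqP/negPn/negP => nzx.
pose v k := iter k (lie e) x.
have tv k : lie t (v k) = v k *+ (m + 2 * k).
  elim: k => [|k IHk]; first by rewrite muln0 addn0.
  rewrite /= lie_der te IHk [lie e (_ *+ _)](raddfMn (lie e)) -scaler_nat lieZl scaler_nat.
  by rewrite -mulrnDr mulnS addnCA.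
have fv k : lie f (v k.+1) = - (v k *+ (k.+1 * (m + k))).
  have fe y : lie f (lie e y) = lie e (lie f y) - lie t y.
    by rewrite lie_der [lie f e]lieC ef lieNl addrC.
  elim: k => [|k IHk]; first by rewrite /= fe efx tx add0r mul1n addn0.
  rewrite -[v k.+2]/(lie e (v k.+1)) fe IHk tv linearN /= raddfMn /= -opprD -mulrnDr.
  by congr (- (_ *+ _)); lia.
apply: (@eigen_chain (ad t) (fun k => (m + 2 * k)%:R) v).
- by move=> i j /eqP; rewrite eqr_nat => /eqP; lia.
- by move=> k; rewrite adE tv scaler_nat.
elim=> [//|k IHk].
apply: contra_neq IHk => vk1; have /eqP := fv k.
rewrite vk1 linear0 eq_sym oppr_eq0 -scaler_nat scaler_eq0 pnatr_eq0.
by rewrite muln_eq0 /= addn_eq0 (gtn_eqF m0) /= => /eqP.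
Qed.

End Sl2.

(** * Structure constants of E6 *)

(** Coordinates on the simple roots; position i stands for the Bourbaki label i + 1. *)
Definition weight := seq int.
Definition vadd (a b : weight) : weight := [seq p.1 + p.2 | p <- zip a b].
Definition vopp (a : weight) : weight := [seq - x | x <- a].
Definition dot (a b : weight) : int := foldr +%R 0 [seq p.1 * p.2 | p <- zip a b].

Definition e6_edges : seq (nat * nat) := [:: (0, 2); (2, 3); (3, 4); (4, 5); (1, 3)]%N.
Definition e6A (i j : nat) : int :=
  if i == j then 2%:Z
  else if ((i, j) \in e6_edges) || ((j, i) \in e6_edges) then - 1%:Z else 0.
Definition coroot_pairing (i : nat) (r : weight) : int :=
  dot [seq e6A i j | j <- iota 0 6] r.

(* The bimultiplicative sign cocycle attached to an orientation of the diagram; with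
   it the structure constants are [x_a, x_b] = e6_sign a b x_(a+b) when a + b is a
   root and [x_a, x_(-a)] = - h_a.  In particular x_(- alpha_i) is - f_i. *)
Definition e6_sign (a b : weight) : int :=
  let q := dot a b + foldr +%R 0 [seq a`_p.1 * b`_p.2 | p <- e6_edges] in
  if odd `|q|%N then - 1%:Z else 1%:Z.

Definition e6_pos : seq weight := [seq [seq (n : nat)%:Z | n <- r] | r <-
  [:: [:: 1; 0; 0; 0; 0; 0]; [:: 0; 1; 0; 0; 0; 0]; [:: 0; 0; 1; 0; 0; 0]; [:: 0; 0; 0; 1; 0; 0];
      [:: 0; 0; 0; 0; 1; 0]; [:: 0; 0; 0; 0; 0; 1]; [:: 1; 0; 1; 0; 0; 0]; [:: 0; 1; 0; 1; 0; 0];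
      [:: 0; 0; 1; 1; 0; 0]; [:: 0; 0; 0; 1; 1; 0]; [:: 0; 0; 0; 0; 1; 1]; [:: 1; 0; 1; 1; 0; 0];
      [:: 0; 1; 1; 1; 0; 0]; [:: 0; 1; 0; 1; 1; 0]; [:: 0; 0; 1; 1; 1; 0]; [:: 0; 0; 0; 1; 1; 1];
      [:: 1; 1; 1; 1; 0; 0]; [:: 1; 0; 1; 1; 1; 0]; [:: 0; 1; 1; 1; 1; 0]; [:: 0; 1; 0; 1; 1; 1];
      [:: 0; 0; 1; 1; 1; 1]; [:: 1; 1; 1; 1; 1; 0]; [:: 1; 0; 1; 1; 1; 1]; [:: 0; 1; 1; 2; 1; 0];
      [:: 0; 1; 1; 1; 1; 1]; [:: 1; 1; 1; 2; 1; 0]; [:: 1; 1; 1; 1; 1; 1]; [:: 0; 1; 1; 2; 1; 1];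
      [:: 1; 1; 2; 2; 1; 0]; [:: 1; 1; 1; 2; 1; 1]; [:: 0; 1; 1; 2; 2; 1]; [:: 1; 1; 2; 2; 1; 1];
      [:: 1; 1; 1; 2; 2; 1]; [:: 1; 1; 2; 2; 2; 1]; [:: 1; 1; 2; 3; 2; 1];
      [:: 1; 2; 2; 3; 2; 1]]%N].

Definition e6_neg : seq weight :=
  [seq vopp r | r <- [seq r <- e6_pos | r`_4 == 0] ++ [seq r <- e6_pos | r`_4 != 0]].

(* Indices of the basis of the Lie algebra: 0..35 are the positive roots by
   increasing height, 36..41 the simple coroots (with the zero vector as weight),
   42..52 the negative roots of the Levi factor, 53..77 the other negative roots.
   The parabolic is the span of the first 53. *)
Definition e6_roots : seq weight :=
  Eval vm_compute in e6_pos ++ nseq 6 (nseq 6 (0 : int)) ++ e6_neg.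

Definition rt (i : nat) : weight := nth [::] e6_roots i.
Definition cartan_idx (i : nat) := (36 <= i < 42)%N.

(** Formal integer combinations of basis vectors; an index may be repeated. *)
Definition comb := seq (nat * int).

(** For opposite roots, the coefficients of [h_a] on the simple coroots are those of [a], since E6
    is simply laced. *)
Definition bracket (i j : nat) : comb :=
  let r := vadd (rt i) (rt j) in
  if cartan_idx i then
    (if cartan_idx j then [::] else [:: (j, coroot_pairing (i - 36) (rt j))])
  else if cartan_idx j then [:: (i, - coroot_pairing (j - 36) (rt i))]
  else if r == nseq 6 0 then [seq ((36 + k)%N, - (rt i)`_k) | k <- iota 0 6]
  else if r \in e6_roots then [:: (index r e6_roots, e6_sign (rt i) (rt j))]
  else [::].

Definition cnorm (s : comb) : comb := [seq p <- s | p.2 != 0].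

Definition bracket_table : seq (seq comb) :=
  Eval vm_compute in
    [seq [seq cnorm (bracket i j) | j <- iota 0 78] | i <- iota 0 78].
Definition tab (i j : nat) : comb := nth [::] (nth [::] bracket_table i) j.

Definition coef (k : nat) (s : comb) : int := foldr +%R 0 [seq p.2 | p <- s & p.1 == k].
Definition cscale (z : int) (s : comb) : comb := [seq (p.1, z * p.2) | p <- s].
Definition tab_comb (i : nat) (s : comb) : comb :=
  flatten [seq cscale p.2 (tab i p.1) | p <- s].
Definition cnull (s : comb) : bool := all (fun k => coef k s == 0) (unzip1 s).
Definition ceq (s t : comb) : bool := cnull (s ++ cscale (- 1) t).

Section Eval.
Variables (K : fieldType) (V : lmodType K) (b : nat -> V).
Implicit Types s t : comb.

Definition ev s : V := \sum_(p <- s) p.2%:~R *: b p.1.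

Lemma ev_nil : ev [::] = 0. Proof. exact: big_nil. Qed.

Lemma ev_cons p s : ev (p :: s) = p.2%:~R *: b p.1 + ev s.
Proof. exact: big_cons. Qed.

Lemma ev_cat s t : ev (s ++ t) = ev s + ev t.
Proof. exact: big_cat. Qed.

Lemma ev_scale z s : ev (cscale z s) = z%:~R *: ev s.
Proof.
rewrite /ev big_map scaler_sumr; apply: eq_bigr => p _ /=.
by rewrite intrM scalerA.
Qed.

Lemma cnullP s : cnull s -> ev s = 0.
Proof.
move=> /allP s0; pose ks := undup (unzip1 s).
have sub p : p \in s -> p.1 \in ks by move=> sp; rewrite mem_undup map_f.
(* Terms are regrouped by index, with total coefficient [coef k s]. *)
transitivity (\sum_(p <- s) \sum_(k <- ks | p.1 == k) p.2%:~R *: b k).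
  rewrite /ev [LHS]big_seq [RHS]big_seq; apply: eq_bigr => p sp.
  rewrite (big_rem p.1) ?sub //= eqxx big1_seq ?addr0 // => k /andP[/eqP <-].
  by rewrite mem_rem_uniq ?undup_uniq // inE eqxx.
rewrite (exchange_big_dep xpredT) //= big1_seq // => k.
rewrite mem_undup => /= /s0 /eqP ck; transitivity ((coef k s)%:~R *: b k).
  rewrite -scaler_suml; congr (_ *: _).
  by rewrite /coef foldrE big_map big_filter rmorph_sum.
by rewrite ck scale0r.
Qed.

Lemma ceqP s t : ceq s t -> ev s = ev t.
Proof.
move/cnullP/eqP; rewrite ev_cat ev_scale scaleN1r => /eqP/subr0_eq //.
Qed.

End Eval.

Section EvalLie.
Variables (K : fieldType) (L : lieAlgType K) (b : nat -> L).

Lemma lie_ev x s : lie x (ev b s) = \sum_(p <- s) p.2%:~R *: lie x (b p.1).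
Proof. by rewrite /ev linear_sum; apply: eq_bigr => p _; rewrite linearZ. Qed.

Lemma ev_tab_comb x i s :
    (forall p, p \in s -> lie x (b p.1) = ev b (tab i p.1)) ->
  lie x (ev b s) = ev b (tab_comb i s).
Proof.
move=> H; rewrite lie_ev /tab_comb; elim: s H => [|p s IHs] H.
  by rewrite big_nil ev_nil.
rewrite big_cons /= ev_cat ev_scale H ?mem_head // IHs // => q sq.
by rewrite H // inE sq orbT.
Qed.

End EvalLie.


(** * Positive root vectors from the Chevalley generators *)

Definition nroot (i : nat) : nat := index (vopp (rt i)) e6_roots.
Definition height (i : nat) : nat := sumn [seq `|x|%N | x <- rt i].
(** A positive root that is not simple pairs to 1 with some simple coroot, and subtracting that
    simple root leaves a root, whose index is [parent]. A simple root is its own parent, which stops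
    the recursion. *)
Definition step_of (k : nat) : nat :=
  find (fun i => coroot_pairing i (rt k) == 1) (iota 0 6).
Definition parent (k : nat) : nat :=
  if (k < 6)%N then k else index (vadd (rt k) (rt (nroot (step_of k)))) e6_roots.
Definition parent_sign (k : nat) : int := coef k (tab (step_of k) (parent k)).

(** Recursion with fuel: since [p k < k] whenever it continues, fuel [k] suffices and any larger
    fuel gives the same value. *)
Lemma recursion_along (T : Type) (g : nat -> T) (h : nat -> T -> T) (p : nat -> nat) :
  exists x : nat -> T,
    forall k, x k = if (p k < k)%N then h k (x (p k)) else g k.
Proof.
pose fix F n k {struct n} :=
  if n is n'.+1 then if (p k < k)%N then h k (F n' (p k)) else g k else g k.
have FE n m k : (k <= n)%N -> (k <= m)%N -> F n k = F m k.
  elim: n m k => [|n IHn] [|m] k //=; try by rewrite leqn0 => /eqP->.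
    by move=> _; rewrite leqn0 => /eqP->.
  move=> kn km; case: ltnP => // pk; rewrite (IHn m) //; lia.
exists (fun k => F k k) => k; case: k => [|k] //=.
by case: ltnP => // pk; rewrite (FE k (p k.+1)) //; lia.
Qed.

Section ChevalleyGenerators.
Variables (K : numFieldType) (L : lieAlgType K).

(* y i stands for - f_i, which makes the conditions symmetric under
   (e, y, t) |-> (y, e, - t). *)
Definition chevalley_generators (e y t : nat -> L) : Prop :=
  forall i j, (i < 6)%N -> (j < 6)%N ->
  [/\ lie (t i) (t j) = 0, lie (t i) (e j) = (e6A i j)%:~R *: e j,
      lie (t i) (y j) = - (e6A i j)%:~R *: y j &
      lie (e i) (y j) = if i == j then - t i else 0].

Lemma chevalley_generatorsC e y t :
  chevalley_generators e y t -> chevalley_generators y e (fun i => - t i).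
Proof.
move=> H i j lti ltj; have [tt te ty ey] := H i j lti ltj.
have [_ _ _ ye] := H j i ltj lti.
split; rewrite ?lieNl ?linearN /= ?tt ?te ?ty ?oppr0 ?scaleNr ?opprK //.
by rewrite lieC ye eq_sym; case: eqP => [->|_]; rewrite ?opprK ?oppr0.
Qed.

(** The finite facts behind [positive_table]: the weight of x_k; the heights in its brackets with
    simple root vectors of both signs; an index i whose coroot is positive on the weight of
    [x_j, x_k], with the Jacobi computation of the image under y_i; a recursive formula for
    [y_j, x_k]. *)
Definition positive_check (j k : nat) : bool :=
  [&& ceq (tab (36 + j) k) [:: (k, coroot_pairing j (rt k))],
      all (fun p => (p.1 < 36)%N && (height p.1 == (height k).+1)) (tab j k),
      all (fun p => cartan_idx p.1 || ((p.1 < 36)%N && ((height p.1).+1 == height k)))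
          (tab (nroot j) k),
      has (fun i => (0 < coroot_pairing i (rt j) + coroot_pairing i (rt k)) &&
             ceq ((if i == j then tab (36 + i) k else [::])
                    ++ tab_comb j (tab (nroot i) k))
                 (tab_comb (nroot i) (tab j k)) &&
             all (fun p => coroot_pairing i (rt p.1)
                    == coroot_pairing i (rt j) + coroot_pairing i (rt k)) (tab j k))
          (iota 0 6) &
      if (k < 6)%N then
        (coroot_pairing j (rt k) == e6A j k) && (parent k == k)
        && ceq (tab (nroot j) k) (if j == k then [:: ((36 + j)%N, 1)] else [::])
      else
      let i := step_of k in let p := parent k in
      [&& (i < 6)%N, (p < k)%N, (height p).+1 == height k,
          coroot_pairing j (rt k) == e6A j i + coroot_pairing j (rt p) &
          ceq (tab (nroot j) k)
            (cscale (parent_sign k)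
               ((if i == j then tab (36 + i) p else [::])
                  ++ tab_comb i (tab (nroot j) p)))]].

Lemma positive_checkP j k : (j < 6)%N -> (k < 36)%N -> positive_check j k.
Proof.
move=> ltj ltk.
have: all (fun j => all (positive_check j) (iota 0 36)) (iota 0 6) by vm_compute.
by move/allP/(_ j); rewrite mem_iota => /(_ ltj)/allP/(_ k); rewrite mem_iota => /(_ ltk).
Qed.

Lemma tab_cartan i c : (i < 6)%N -> (c < 6)%N ->
  ceq (tab i (36 + c)) [:: (i, - e6A c i)].
Proof.
move=> lti ltc.
have: all (fun i => all (fun c => ceq (tab i (36 + c)) [:: (i, - e6A c i)])
        (iota 0 6)) (iota 0 6) by vm_compute.
by move/allP/(_ i); rewrite mem_iota => /(_ lti)/allP/(_ c); rewrite mem_iota => /(_ ltc).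
Qed.

Definition positive_family (x t : nat -> L) (k : nat) : L :=
  if (k < 36)%N then x k else t (k - 36)%N.

(* By induction on the height: [f_j, x_k] is computed by the Jacobi identity from
   x_k = +- [e_i, x_p], and an equality between weight vectors whose weight is
   positive on some coroot t_i follows from its image under ad f_i. *)
Lemma positive_table e y t : chevalley_generators e y t ->
  exists2 x : nat -> L, (forall i, (i < 6)%N -> x i = e i) &
  forall j k, (j < 6)%N -> (k < 36)%N ->
  let b := positive_family x t in
  [/\ lie (t j) (x k) = (coroot_pairing j (rt k))%:~R *: x k,
      lie (e j) (x k) = ev b (tab j k) &
      lie (y j) (x k) = ev b (tab (nroot j) k)].
Proof.
move=> gen.
have [x xE] := recursion_along e
  (fun k z => (parent_sign k)%:~R *: lie (e (step_of k)) z) parent.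
have xs i : (i < 6)%N -> x i = e i.
  by move=> lti; rewrite xE /parent lti ltnn.
exists x => // j k ltj ltk b; move: j k ltj ltk.
have xp k : (6 <= k)%N -> (k < 36)%N ->
    x k = (parent_sign k)%:~R *: lie (e (step_of k)) (x (parent k)).
  move=> lek ltk; rewrite xE; have /and5P[_ _ _ _] := @positive_checkP 0 k isT ltk.
  by rewrite ltnNge lek /= => /and5P[_ -> _ _ _].
have Tx k : (k < 36)%N -> forall j, (j < 6)%N ->
    lie (t j) (x k) = (coroot_pairing j (rt k))%:~R *: x k.
  elim/ltn_ind: k => k IHk ltk j ltj.
  have /and5P[_ _ _ _] := positive_checkP ltj ltk; case: ltnP => lek.
    by move=> /andP[/andP[/eqP-> _] _]; rewrite xs //; case: (gen j k).
  move=> /and5P[lti ltp _ /eqP-> _]; rewrite xp // linearZ /= lie_der IHk //; last lia.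
  have [_ -> _ _] := gen j (step_of k) ltj lti.
  by rewrite lieZl linearZ /= -scalerDl -intrD scalerA mulrC -scalerA.
have bx k : (k < 36)%N -> b k = x k by rewrite /b /positive_family => ->.
have bt c : (c < 6)%N -> b (36 + c)%N = t c.
  by move=> ltc; rewrite /b /positive_family ltnNge leq_addr /= addKn.
have bc k : cartan_idx k -> exists2 c, (c < 6)%N & k = (36 + c)%N.
  by move=> /andP[le36 lt42]; exists (k - 36)%N; lia.
have Tb j k : (j < 6)%N -> (k < 36)%N -> lie (t j) (x k) = ev b (tab (36 + j) k).
  move=> ltj ltk; have /and5P[/ceqP-> _ _ _ _] := positive_checkP ltj ltk.
  by rewrite Tx // ev_cons ev_nil addr0 bx.
have Eb i c : (i < 6)%N -> (c < 6)%N -> lie (e i) (t c) = ev b (tab i (36 + c)).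
  move=> lti ltc; rewrite (ceqP _ (tab_cartan lti ltc)) ev_cons ev_nil addr0 /=.
  rewrite bx ?xs //; last lia.
  by rewrite lieC; case: (gen c i ltc lti) => _ -> _ _; rewrite mulrNz scaleNr.
have ye i j z : (i < 6)%N -> (j < 6)%N -> lie (y j) (lie (e i) z) =
    (if i == j then lie (t i) z else 0) + lie (e i) (lie (y j) z).
  move=> lti ltj; rewrite lie_der; congr (_ + _); rewrite [lie (y j) _]lieC.
  have [_ _ _ ->] := gen i j lti ltj.
  by case: ifP => _; rewrite ?opprK ?oppr0 ?lie0l.
(* The two tables are proved together: [[e_j, x_k]] at height n needs [[y_i, .]] up to height n + 1,
   which needs [[e_i, .]] only below height n. *)
suff main n : (forall j k, (j < 6)%N -> (k < 36)%N -> (height k <= n)%N ->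
       lie (y j) (x k) = ev b (tab (nroot j) k)) /\
     (forall j k, (j < 6)%N -> (k < 36)%N -> (height k < n)%N ->
       lie (e j) (x k) = ev b (tab j k)).
  move=> j k ltj ltk; have [Y E] := main (height k).+1.
  by split; [exact: Tx | exact: E | exact: Y].
elim: n => [|n [IHY IHE]].
  split=> j k _ ltk; last by rewrite ltn0.
  have: all (fun k => 0 < height k)%N (iota 0 36) by vm_compute.
  by move/allP/(_ k); rewrite mem_iota => /(_ ltk); rewrite lt0n leqn0 => /negPf ->.
have Estep j k : (j < 6)%N -> (k < 36)%N -> (height k <= n)%N -> forall i, (i < 6)%N ->
    lie (e j) (lie (y i) (x k)) = ev b (tab_comb j (tab (nroot i) k)).
  move=> ltj ltk hk i lti; rewrite IHY //.
  have /and5P[_ _ /allP neg _ _] := positive_checkP lti ltk.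
  apply: ev_tab_comb => -[q z] /neg /= /orP[/bc[c ltc ->]|/andP[ltq /eqP hq]].
    by rewrite bt ?Eb.
  by rewrite bx ?IHE //; lia.
have Ystep j k : (j < 6)%N -> (k < 36)%N -> (height k <= n.+1)%N ->
       lie (y j) (x k) = ev b (tab (nroot j) k).
  move=> ltj ltk hk; have /and5P[_ _ _ _] := positive_checkP ltj ltk.
  case: ltnP => lek.
    move=> /andP[_ /ceqP ->]; rewrite xs // lieC; have [_ _ _ ->] := gen k j lek ltj.
    rewrite eq_sym; case: eqP => [->|_]; last by rewrite oppr0 ev_nil.
    by rewrite ev_cons ev_nil addr0 scale1r bt ?opprK.
  move=> /and5P[lti ltp /eqP hp _ /ceqP ->]; rewrite ev_scale ev_cat xp //.
  rewrite linearZ /= ye // Estep //; [|lia..].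
  by congr (_ *: (_ + _)); case: eqP => _; rewrite ?Tb ?ev_nil //; lia.
split=> // j k ltj ltk hk.
have /and5P[_ /allP pos _ hs _] := positive_checkP ltj ltk.
case/hasP: hs => i; rewrite mem_iota => /= lti /andP[/andP[wt_gt0 /ceqP eqc] /allP wts].
have [Tii tei _ eyi] := gen i i lti lti.
apply/eqP; rewrite -subr_eq0; apply/eqP.
set w := (_ + _) in wt_gt0 wts.
apply: (@sl2_positive_weight K L (e i) (- y i) (t i) _ `|w|%N).
- by rewrite linearN /= eyi eqxx opprK.
- by rewrite tei /e6A eqxx scaler_int.
- lia.
- have -> : forall v : L, v *+ `|w|%N = w%:~R *: v.
    by move=> v; rewrite -[in RHS](gtz0_abs wt_gt0) -scaler_nat.
  rewrite linearB scalerBr /=; congr (_ - _).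
    rewrite lie_der Tx // -[e j]xs // Tx //; last lia.
    by rewrite lieZl linearZ -scalerDl -intrD.
  rewrite lie_ev scaler_sumr !big_seq; apply: eq_bigr => -[q z] sq /=.
  have /andP[/= ltq _] := pos _ sq; have /eqP/= wq := wts _ sq.
  by rewrite bx // Tx // wq !scalerA mulrC.
- rewrite lieNl linearB /= ye // [j == i]eq_sym Estep //.
  rewrite (@ev_tab_comb _ _ _ (y i) (nroot i)); last first.
    by move=> -[q z] /pos/= /andP[ltq /eqP hq]; rewrite bx // Ystep //; lia.
  rewrite -eqc ev_cat; case: eqP => [->|_]; rewrite ?Tb ?ev_nil //.
    by rewrite subrr oppr0 linear0.
  by rewrite subrr oppr0 linear0.
Qed.

End ChevalleyGenerators.

(** * The Chevalley involution and finite checks on the table *)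

(** The Chevalley involution: it exchanges x_a with x_(-a) and is -1 on the Cartan subalgebra. *)
Definition neg_comb (s : comb) : comb :=
  [seq if cartan_idx p.1 then (p.1, - p.2) else (nroot p.1, p.2) | p <- s].

Definition neg_check (j k : nat) : bool :=
  let q := nroot k in
  [&& (q < 36)%N, nroot q == k,
      ceq (tab (36 + j) k) [:: (k, - coroot_pairing j (rt q))],
      ceq (neg_comb (tab (nroot j) q)) (tab j k) &
      ceq (neg_comb (tab j q)) (tab (nroot j) k)].

(** Simple root vectors, simple coroots, and the negative simple root vectors of the Levi factor. *)
Definition gen_idx (i : nat) : bool :=
  [|| (i < 6)%N, cartan_idx i | (42 <= i < 47)%N].

Definition nstep_of (i : nat) : nat :=
  if (i < 36)%N then step_of i else nroot (step_of (nroot i)).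
Definition nparent (i : nat) : nat :=
  if (i < 36)%N then parent i else nroot (parent (nroot i)).

Definition commutator_comb (g p j : nat) : comb :=
  tab_comb g (tab p j) ++ cscale (- 1) (tab_comb p (tab g j)).

(** Certifies that x_i is, up to sign, the bracket of a generator x_g with some x_p, [p < i], and
    that row i of the table follows from rows g and p by the Jacobi identity. *)
Definition step_check (i g p : nat) (z : int) : bool :=
  [&& gen_idx g, (g < 53)%N, (p < i)%N, z * z == 1, tab g p == [:: (i, z)] &
      all (fun j => ceq (cscale z (commutator_comb g p j)) (tab i j)) (iota 0 53)].

Definition small_comb (n : nat) (s : comb) : bool := all (fun p => (p.1 < n)%N) s.

Lemma allP_iota (P : pred nat) m n :
  all P (iota m n) -> forall i, (m <= i)%N -> (i < m + n)%N -> P i.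
Proof. by move=> /allP H i le lt; apply: H; rewrite mem_iota le. Qed.

Lemma all2_iota (P : nat -> nat -> bool) m n m' n' :
    all (fun i => all (P i) (iota m' n')) (iota m n) ->
  forall i j, (m <= i < m + n)%N -> (m' <= j < m' + n')%N -> P i j.
Proof.
move=> /allP H i j hi hj; have /H/allP H' : i \in iota m n by rewrite mem_iota.
by apply: H'; rewrite mem_iota.
Qed.

Lemma nrootK k : (k < 36)%N -> (42 <= nroot k)%N && (nroot (nroot k) == k).
Proof.
have H : all (fun k => (42 <= nroot k)%N && (nroot (nroot k) == k)) (iota 0 36).
  by vm_compute.
by move=> ltk; apply: (allP_iota H).
Qed.

Lemma tab_simple_small i j : (i < 6)%N -> (j < 36)%N ->
  small_comb 42 (tab i j) && small_comb 42 (tab (nroot i) j).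
Proof.
pose P i j := small_comb 42 (tab i j) && small_comb 42 (tab (nroot i) j).
have H : all (fun i => all (P i) (iota 0 36)) (iota 0 6) by vm_compute.
by move=> lti ltj; exact: (all2_iota H).
Qed.

Definition cartan_check i c :=
  [&& nilp (tab (36 + i) (36 + c)), ceq (tab i (36 + c)) [:: (i, - e6A c i)] &
      ceq (tab (nroot i) (36 + c)) [:: (nroot i, e6A c i)]].

Lemma cartan_checkP i c : (i < 6)%N -> (c < 6)%N -> cartan_check i c.
Proof.
have H : all (fun i => all (cartan_check i) (iota 0 6)) (iota 0 6) by vm_compute.
by move=> lti ltc; exact: (all2_iota H).
Qed.

Lemma neg_checkP j k : (j < 6)%N -> (42 <= k < 53)%N -> neg_check j k.
Proof.
have H : all (fun j => all (neg_check j) (iota 42 11)) (iota 0 6) by vm_compute.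
by move=> ltj ltk; exact: (all2_iota H).
Qed.

Lemma step_checkP i : (i < 53)%N -> ~~ gen_idx i ->
  exists g p z, step_check i g p z.
Proof.
pose P i := gen_idx i ||
  step_check i (nstep_of i) (nparent i) (coef i (tab (nstep_of i) (nparent i))).
have H : all P (iota 0 53) by vm_compute.
move=> lti /negPf ngi; have : P i by apply: (allP_iota H).
by rewrite /P ngi => Hi; do 3 eexists; exact: Hi.
Qed.

Lemma tab_closed i j : (i < 53)%N -> (j < 53)%N -> small_comb 53 (tab i j).
Proof.
pose P i j := small_comb 53 (tab i j).
have H : all (fun i => all (P i) (iota 0 53)) (iota 0 53) by vm_compute.
by move=> lti ltj; exact: (all2_iota H).
Qed.

Lemma gen_nroot i : (42 <= i < 47)%N -> exists2 j, (j < 6)%N & i = nroot j.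
Proof.
have H : all (fun i => i \in [seq nroot i | i <- iota 0 6]) (iota 42 5) by vm_compute.
case/andP=> le lt; have /mapP[j] := allP_iota H le lt.
by rewrite mem_iota => ltj ->; exists j.
Qed.

(** * Weights and the E6 form *)

Definition root_of (c : 'I_6 -> nat) : weight := [seq (c (inord k))%:Z | k <- iota 0 6].
Definition lower (c : 'I_6 -> nat) (i : 'I_6) : 'I_6 -> nat := fun j => (c j - (j == i))%N.

Lemma coroot_pairing_root_of (c : 'I_6 -> nat) (i : 'I_6) :
  coroot_pairing i (root_of c) = \sum_(j < 6) e6A i j * (c j)%:Z.
Proof.
have -> : root_of c = [seq (c j)%:Z | j <- enum 'I_6].
  rewrite /root_of -val_enum_ord -map_comp; apply/eq_map => j /=.
  by rewrite inord_val.
rewrite /coroot_pairing -[iota 0 6]val_enum_ord -map_comp /dot.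
by rewrite zip_map -map_comp foldrE big_map big_enum.
Qed.

(* Six times the E6 form is
   3(2a-c)^2 + (3c-2d)^2 + 3(2f-e)^2 + (3e-2d)^2 + 3(2b-d)^2 + d^2. *)
Lemma e6_form_pos (a b c d e f : int) :
    a * (2 * a - c) + b * (2 * b - d) + c * (2 * c - a - d) + d * (2 * d - c - e - b)
      + e * (2 * e - d - f) + f * (2 * f - e) <= 0 ->
  a = 0 /\ b = 0 /\ c = 0 /\ d = 0 /\ e = 0 /\ f = 0.
Proof.
set q := (X in X <= 0) => q0.
have E : 6 * q = 3 * (2 * a - c) ^+ 2 + (3 * c - 2 * d) ^+ 2 + 3 * (2 * f - e) ^+ 2
    + (3 * e - 2 * d) ^+ 2 + 3 * (2 * b - d) ^+ 2 + d ^+ 2 by rewrite /q; ring.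
have s (x : int) : 0 <= x ^+ 2 by exact: sqr_ge0.
have := (s (2 * a - c), s (3 * c - 2 * d), s (2 * f - e), s (3 * e - 2 * d), s (2 * b - d), s d).
move=> [[[[[h1 h2] h3] h4] h5] h6].
have z (x : int) : x ^+ 2 <= 0 -> x = 0.
  by move=> xx; apply/eqP; rewrite -sqrf_eq0 eq_le xx sqr_ge0.
have /z d0 : d ^+ 2 <= 0 by lia.
have /z c0 : (3 * c - 2 * d) ^+ 2 <= 0 by lia.
have /z e0 : (3 * e - 2 * d) ^+ 2 <= 0 by lia.
have /z a0 : (2 * a - c) ^+ 2 <= 0 by lia.
have /z f0 : (2 * f - e) ^+ 2 <= 0 by lia.
have /z b0 : (2 * b - d) ^+ 2 <= 0 by lia.
by do !split; lia.
Qed.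

(** Otherwise each product of [c i] with the i-th pairing is nonpositive, and so is their sum, which
    is the value at [c] of a positive definite form. *)
Lemma lowerable_index (c : 'I_6 -> nat) : (exists j, c j != 0%N) ->
  exists2 i, (0 < c i)%N & 0 < coroot_pairing i (root_of c).
Proof.
move=> nz; have [/existsP[i /andP[ci pi]]|] := boolP
  [exists i : 'I_6, (0 < c i)%N && (0 < coroot_pairing i (root_of c))]; first by exists i.
move/existsPn => H; exfalso.
have le i : (c i)%:Z * coroot_pairing i (root_of c) <= 0.
  have := H i; rewrite negb_and lt0n negbK -leNgt => /orP[/eqP->|]; first by rewrite mul0r.
  by move=> pi; rewrite mulr_ge0_le0.
have : \sum_(i < 6) (c i)%:Z * coroot_pairing i (root_of c) <= 0 by apply: sumr_le0.
under eq_bigr => i _ do rewrite coroot_pairing_root_of.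
rewrite !big_ord_recl !big_ord0 /e6A /= => q0.
pose o1 : 'I_6 := lift ord0 ord0; pose o2 : 'I_6 := lift ord0 (lift ord0 ord0).
pose o3 : 'I_6 := lift ord0 (lift ord0 (lift ord0 ord0)).
pose o4 : 'I_6 := lift ord0 (lift ord0 (lift ord0 (lift ord0 ord0))).
pose o5 : 'I_6 := lift ord0 (lift ord0 (lift ord0 (lift ord0 (lift ord0 ord0)))).
have [] := @e6_form_pos (c ord0) (c o1) (c o2) (c o3) (c o4) (c o5).
  by apply: le_trans q0; rewrite le_eqVlt /o1 /o2 /o3 /o4 /o5; apply/orP; left; apply/eqP; ring.
move=> c0 [c1 [c2 [c3 [c4 c5]]]]; case: nz => j /eqP; apply.
have : j \in enum 'I_6 by rewrite mem_enum.
have -> : enum 'I_6 = [:: ord0; o1; o2; o3; o4; o5].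
  by apply: (inj_map val_inj); rewrite val_enum_ord.
by rewrite !inE => /or4P[/eqP->|/eqP->|/eqP->|/or3P[]/eqP->]; lia.
Qed.

Lemma rt_index w : (index w e6_roots < 78)%N -> rt (index w e6_roots) = w.
Proof. by move=> lt; rewrite /rt nth_index // -index_mem. Qed.



Lemma simple_rt i : (i < 6)%N -> rt i = [seq (i == j)%:Z | j <- iota 0 6].
Proof.
have H : all (fun i => rt i == [seq (i == j)%:Z | j <- iota 0 6]) (iota 0 6) by vm_compute.
by move=> lti; apply/eqP; apply: (allP_iota H).
Qed.

Lemma root_of_lower c i : (0 < c i)%N -> vadd (root_of (lower c i)) (rt i) = root_of c.
Proof.
move=> ci; have e (j : 'I_6) : ((lower c i j)%:Z + (i == j)%:Z = c j)%R.
  by rewrite /lower [i == j]eq_sym; case: eqP => [->|_]; lia.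
have -> : rt i = [seq (i == j)%:Z | j <- enum 'I_6].
  by rewrite simple_rt // -val_enum_ord -map_comp; exact/eq_map.
have rE c' : root_of c' = [seq (c' j)%:Z | j <- enum 'I_6].
  rewrite /root_of -val_enum_ord -map_comp; apply/eq_map => j /=.
  by rewrite inord_val.
rewrite !rE /vadd zip_map -map_comp; apply/eq_map => j /=; exact: e.
Qed.

Definition lower_check (i k k' : nat) : bool :=
  (vadd (rt k') (rt i) == rt k) ==>
  (if tab (nroot i) k is [:: (q, z)] then (q == k') && (z != 0) else false).

Lemma lower_checkP i k k' : (i < 6)%N -> (k < 36)%N -> (k' < 36)%N ->
  vadd (rt k') (rt i) = rt k ->
  exists2 z, tab (nroot i) k = [:: (k', z)] & z != 0.
Proof.
have H : all (fun i => all (fun k => all (lower_check i k) (iota 0 36)) (iota 0 36)) (iota 0 6).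
  by vm_compute.
move=> lti ltk ltk' e; have /allP_iota-/(_ k') := all2_iota H (i := i) (j := k) lti ltk.
move=> /(_ isT ltk'); rewrite /lower_check e eqxx /=; clear H.
by case: (tab _ _) => [|[q z] [|//]] // /andP[/eqP-> z0]; exists z.
Qed.

Lemma no_root_tab i k : (i < 6)%N -> (k < 36)%N ->
  (36 <= index (vadd (rt k) (rt i)) e6_roots)%N -> tab i k = [::].
Proof.
pose P i k := (36 <= index (vadd (rt k) (rt i)) e6_roots)%N ==> nilp (tab i k).
have H : all (fun i => all (P i) (iota 0 36)) (iota 0 6) by vm_compute.
move=> lti ltk le; have := all2_iota H (i := i) (j := k) lti ltk.
by rewrite /P le => /nilP.
Qed.

Lemma simple_index i : (i < 6)%N -> index (rt i) e6_roots = i.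
Proof.
have H : all (fun i => index (rt i) e6_roots == i) (iota 0 6) by vm_compute.
by move=> lti; apply/eqP; apply: (allP_iota H).
Qed.

Definition wt_index (c : 'I_6 -> nat) : nat := index (root_of c) e6_roots.

Lemma rt_wt_index c : (wt_index c < 36)%N -> rt (wt_index c) = root_of c.
Proof. by move=> lt; apply: rt_index; apply: leq_trans lt _. Qed.

Lemma wt_index_simple c (i : 'I_6) : (forall j, c j = nat_of_bool (j == i)) -> wt_index c = i.
Proof.
move=> ce; rewrite /wt_index -[RHS](simple_index (ltn_ord i)).
congr index; rewrite simple_rt // /root_of -val_enum_ord -!map_comp.
by apply/eq_map => j /=; rewrite inord_val ce eq_sym.
Qed.

Opaque tab rt nroot coroot_pairing wt_index.

(** * Brackets among the 53 basis vectors *)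

Section ParabolicTable.
Variables (K : numFieldType) (L : lieAlgType K).

Lemma eq_ev (V : lmodType K) (b c : nat -> V) s :
  {in unzip1 s, b =1 c} -> ev b s = ev c s.
Proof.
move=> bc; rewrite /ev !big_seq; apply: eq_bigr => p sp.
by rewrite bc ?map_f.
Qed.

Section Family.
Variables (e y t x x' : nat -> L).
Hypothesis gen : chevalley_generators e y t.
Hypothesis xs : forall i, (i < 6)%N -> x i = e i.
Hypothesis xs' : forall i, (i < 6)%N -> x' i = y i.
Hypothesis X : forall j k, (j < 6)%N -> (k < 36)%N ->
  let b := positive_family x t in
  [/\ lie (t j) (x k) = (coroot_pairing j (rt k))%:~R *: x k,
      lie (e j) (x k) = ev b (tab j k) &
      lie (y j) (x k) = ev b (tab (nroot j) k)].
Hypothesis X' : forall j k, (j < 6)%N -> (k < 36)%N ->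
  let b := positive_family x' (fun i => - t i) in
  [/\ lie (- t j) (x' k) = (coroot_pairing j (rt k))%:~R *: x' k,
      lie (y j) (x' k) = ev b (tab j k) &
      lie (e j) (x' k) = ev b (tab (nroot j) k)].

Definition e6_family i :=
  if (i < 36)%N then x i else if (i < 42)%N then t (i - 36)%N else x' (nroot i).
Local Notation b := e6_family.

Lemma e6_family_pos k : (k < 36)%N -> b k = x k.
Proof. by rewrite /b => ->. Qed.

Lemma e6_family_cartan c : (c < 6)%N -> b (36 + c)%N = t c.
Proof. by move=> ltc; rewrite /b ltnNge leq_addr addKn ltn_add2l ltc. Qed.

Lemma e6_family_neg k : (k < 36)%N -> b (nroot k) = x' k.
Proof.
move=> /nrootK/andP[le42 /eqP ne]; rewrite /b.
by rewrite !ifF ?ne //; apply/negbTE; rewrite -leqNgt // (leq_trans _ le42).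
Qed.

Lemma ev_positive_family s : small_comb 42 s -> ev (positive_family x t) s = ev b s.
Proof.
move=> /allP sm; apply: eq_ev => _ /mapP[p /sm ltp ->].
by rewrite /b /positive_family ltp.
Qed.

Lemma ev_negative_family s : small_comb 42 s ->
  ev (positive_family x' (fun i => - t i)) s = ev b (neg_comb s).
Proof.
move=> /allP sm; rewrite /ev big_map !big_seq; apply: eq_bigr => p /sm ltp.
rewrite /positive_family /cartan_idx ltp andbT.
case: (ltnP p.1 36) => [lt36|le36] /=; first by rewrite e6_family_neg.
rewrite mulrNz scaleNr scalerN -[in b _](subnKC le36) e6_family_cartan //.
by rewrite -(ltn_add2l 36) subnKC.
Qed.

Lemma e6_family_gens j k : (j < 6)%N -> (k < 53)%N ->
   [/\ lie (e j) (b k) = ev b (tab j k), lie (t j) (b k) = ev b (tab (36 + j) k) &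
       lie (y j) (b k) = ev b (tab (nroot j) k)].
Proof.
have s36 i : (i < 6)%N -> (i < 36)%N by move/leq_trans; apply.
move=> ltj ltk; have [lt36|le36] := ltnP k 36.
  have [Tk Ek Yk] := X ltj lt36; have /andP[s1 s2] := tab_simple_small ltj lt36.
  have /and5P[/ceqP-> _ _ _ _] := positive_checkP ltj lt36.
  rewrite e6_family_pos // Ek Yk Tk !ev_positive_family //; split=> //.
  by rewrite ev_cons ev_nil addr0 e6_family_pos.
have [lt42|le42] := ltnP k 42.
  have [c ltc ->] : exists2 c, (c < 6)%N & k = (36 + c)%N.
    by exists (k - 36)%N; rewrite ?subnKC // -(ltn_add2l 36) subnKC.
  have /and3P[/nilP-> /ceqP-> /ceqP->] := cartan_checkP ltj ltc.
  have [tt _ _ _] := gen ltj ltc; have [_ te ty _] := gen ltc ltj.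
  rewrite !e6_family_cartan // !ev_cons !ev_nil !addr0 /=; split=> //.
    by rewrite lieC te e6_family_pos ?xs ?s36 // mulrNz scaleNr.
  by rewrite lieC ty scaleNr opprK e6_family_neg ?xs' ?s36.
have /and5P[ltq /eqP qk c1 /ceqP<- /ceqP<-] : neg_check j k.
  by apply: neg_checkP; rewrite ?le42.
have [] := X' ltj ltq; rewrite lieNl -e6_family_neg // qk => Tk Ek Yk.
have /andP[s1 s2] := tab_simple_small ltj ltq.
rewrite Ek Yk !ev_negative_family //; split=> //.
by rewrite (ceqP _ c1) ev_cons ev_nil addr0 /= mulrNz scaleNr -Tk opprK.
Qed.

Lemma e6_family_gen_idx i : gen_idx i -> (i < 53)%N ->
  forall k, (k < 53)%N -> lie (b i) (b k) = ev b (tab i k).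
Proof.
have s36 j : (j < 6)%N -> (j < 36)%N by move/leq_trans; apply.
case/or3P=> [lti|/andP[le36 lt42]|hi] lt53 k ltk.
- by rewrite e6_family_pos ?xs ?s36 //; case: (e6_family_gens lti ltk).
- have [c ltc ->] : exists2 c, (c < 6)%N & i = (36 + c)%N.
    by exists (i - 36)%N; rewrite ?subnKC // -(ltn_add2l 36) subnKC.
  by rewrite e6_family_cartan //; case: (e6_family_gens ltc ltk).
have [j ltj ->] := gen_nroot hi.
by rewrite e6_family_neg ?xs' ?s36 //; case: (e6_family_gens ltj ltk).
Qed.

(** Induction on [i]: outside the generators, [b i] is up to sign [[b g, b p]] with [p < i], so its
    adjoint action is up to sign a commutator of two known ones. *)
Lemma e6_family_bracket i j : (i < 53)%N -> (j < 53)%N ->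
  lie (b i) (b j) = ev b (tab i j).
Proof.
elim/ltn_ind: i j => i IHi j lti ltj.
have [gi|ngi] := boolP (gen_idx i); first exact: e6_family_gen_idx.
have [g [p [z]]] := step_checkP lti ngi; rewrite /step_check.
case/and5P=> gg ltg ltp /eqP zz /andP[/eqP tgp /allP_iota allj].
rewrite -(ceqP _ (allj j _ _)) //.
have ltp53 : (p < 53)%N by apply: ltn_trans lti.
have -> : b i = z%:~R *: lie (b g) (b p).
  by rewrite e6_family_gen_idx // tgp ev_cons ev_nil addr0 scalerA -intrM zz scale1r.
rewrite lieZl ev_scale /commutator_comb ev_cat ev_scale scaleN1r; congr (_ *: _).
rewrite -(@ev_tab_comb _ _ b (b g)); last first.
  by move=> q /(allP (tab_closed ltp53 ltj)) ltq; apply: e6_family_gen_idx.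
rewrite -(@ev_tab_comb _ _ b (b p)); last first.
  by move=> q /(allP (tab_closed ltg ltj)) ltq; apply: IHi.
by rewrite -(e6_family_gen_idx gg) // -(IHi p) // [lie (b g) (lie _ _)]lie_der addrK.
Qed.

End Family.

(** The second clause includes the [y i] of the node outside the Levi factor: it is not in the
    parabolic, but the descent in the root spaces uses it. *)
Lemma parabolic_table (e y t : nat -> L) : chevalley_generators e y t ->
  exists b : nat -> L,
  [/\ forall i, (i < 6)%N -> [/\ b i = e i, b (36 + i)%N = t i & b (nroot i) = y i],
      forall i k, (i < 6)%N -> (k < 53)%N ->
        [/\ lie (e i) (b k) = ev b (tab i k), lie (t i) (b k) = ev b (tab (36 + i) k) &
            lie (y i) (b k) = ev b (tab (nroot i) k)] &
      forall i j, (i < 53)%N -> (j < 53)%N -> lie (b i) (b j) = ev b (tab i j)].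
Proof.
move=> gen; have [x xs X] := positive_table gen.
have [x' xs' X'] := positive_table (chevalley_generatorsC gen).
exists (e6_family t x x'); split=> [i lti|i k lti ltk|i j lti ltj].
- have lt36 : (i < 36)%N by apply: leq_trans lti _.
  by rewrite e6_family_cartan // e6_family_pos // e6_family_neg ?xs ?xs'.
- exact: (e6_family_gens gen xs xs' X X').
exact: (e6_family_bracket gen xs xs' X X').
Qed.

End ParabolicTable.

(** * Root spaces and the parabolic subalgebra *)

Section RootSpaces.
Variables (K : fieldType) (L : lieAlgType K) (h : {vspace L}).
Implicit Types (beta gamma : 'Hom(subvs_of h, K^o)) (x y z : L).

Lemma root_space_lie beta gamma x y : x \in root_space beta -> y \in root_space gamma ->
  lie x y \in root_space (beta + gamma).
Proof.
move=> /root_spaceP xb /root_spaceP yg; apply/root_spaceP => t.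
by rewrite lie_der xb yg lieZl linearZ -scalerDl add_lfunE.
Qed.

Lemma root_space0 x : is_cartan h -> x \in root_space (0 : 'Hom(subvs_of h, K^o)) -> x \in h.
Proof.
case=> _ _ hN /root_spaceP x0; apply: hN => y yh.
have := x0 (Subvs yh); rewrite zero_lfunE scale0r /= lieC => /eqP.
by rewrite oppr_eq0 => /eqP->; rewrite mem0v.
Qed.

Variables (n : nat) (alpha : 'I_n -> 'Hom(subvs_of h, K^o)).
Hypothesis alpha_base : is_base alpha.

(** The simple roots span the dual of [h]. *)
Lemma base_separates (s : subvs_of h) : (forall i, alpha i s = 0) -> s = 0.
Proof.
move=> s0; have [/andP[/eqP spanA _] _ _] := alpha_base.
have dual0 (beta : 'Hom(subvs_of h, K^o)) : beta s = 0.
  have: beta \in <<[seq alpha i | i : 'I_n]>>%VS by rewrite spanA memvf.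
  move/coord_span=> ->; rewrite sum_lfunE big1 // => i _; rewrite scale_lfunE.
  have /mapP[j _ ->] : [seq alpha i | i : 'I_n]`_i \in [seq alpha i | i : 'I_n].
    by apply: mem_nth; rewrite size_image.
  by rewrite [alpha j s]s0 scaler0.
rewrite (coord_vbasis (memvf s)) big1 // => i _.
have := dual0 (linfun (coord (vbasis fullv) i : _ -> K^o)).
by rewrite lfunE /= => ->; rewrite scale0r.
Qed.

(** On a nonzero vector of a simple root space, [lie x y] acts as a commutator of scalars; hence
    every simple root vanishes on it. *)
Lemma cartan_abelian : is_subalgebra h -> {in h &, forall x y, lie x y = 0}.
Proof.
move=> hS x y xh yh; suff: Subvs (hS x y xh yh) = 0 by move/(congr1 vsval).
apply: base_separates => i; have [_ /(_ i)[_ nz] _] := alpha_base.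
have [v vi nzv] : exists2 v, v \in root_space (alpha i) & v != 0.
  by exists (vpick (root_space (alpha i))); rewrite ?memv_pick ?vpick0.
have/root_spaceP av := vi; apply/eqP; have := av (Subvs (hS x y xh yh)).
move=> /= /esym/eqP; have -> : lie (lie x y) v = lie x (lie y v) - lie y (lie x v).
  by rewrite lie_der addrK.
have xv : lie x v = _ *: v := av (Subvs xh); have yv : lie y v = _ *: v := av (Subvs yh).
rewrite yv xv !linearZ /= xv yv scalerN !scalerA mulrC subrr.
by rewrite scaler_eq0 (negPf nzv) orbF.
Qed.

End RootSpaces.

(** * Chevalley generators from the base *)

Section SimpleRoots.
Variables (K : numFieldType) (L : lieAlgType K) (h : {vspace L}).
Hypothesis h_cartan : is_cartan h.
Implicit Types (beta gamma : 'Hom(subvs_of h, K^o)) (x y z : L).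

(* Subtract from w the multiple of e that makes [f, w] commute with e and f. *)
Lemma sl2_root_line beta e f (s : subvs_of h) :
    e \in root_space beta -> f \in root_space (- beta) -> lie e f = vsval s ->
    beta s = 2%:R ->
  (root_space beta <= <[e]>)%VS.
Proof.
move=> eb fb efs bs; apply/subvP => w wb.
have br0 x y : x \in root_space beta -> y \in root_space (- beta) ->
    exists r : subvs_of h, lie x y = vsval r.
  move=> xb yb; have := root_space_lie xb yb; rewrite subrr => /(root_space0 h_cartan) xy.
  by exists (Subvs xy).
have [r wfr] := br0 w f wb fb.
have wE : w - (beta r / 2) *: e = 0.
  have /root_spaceP ee := eb; have /root_spaceP ww := wb.
  apply: (@sl2_positive_weight K L e f (vsval s) _ 2) => //.
  - by rewrite ee bs scaler_nat.
  - by rewrite linearB linearZ /= ww ee bs -[RHS]scaler_nat scalerBr !scalerA mulrC.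
  rewrite linearB linearZ /= [lie f w]lieC wfr [lie f e]lieC efs scalerN opprK.
  rewrite linearD linearN linearZ /= ![lie e (vsval _)]lieC !ee bs opprK scalerN.
  by rewrite scalerA divfK ?pnatr_eq0 // subrr.
by apply/vlineP; exists (beta r / 2); apply/eqP; rewrite -subr_eq0 wE.
Qed.

Lemma root_space_act beta x (s : subvs_of h) :
  x \in root_space beta -> lie (vsval s) x = (beta s : K) *: x.
Proof. by move/root_spaceP. Qed.

Variables (alpha : 'I_6 -> 'Hom(subvs_of h, K^o)).
Hypothesis alpha_base : is_base alpha.
Hypothesis alpha_E6 : has_cartan_matrix alpha E6_cartan.

Lemma E6_cartanE (i j : 'I_6) : E6_cartan i j = e6A i j.
Proof.
by case: i => [[|[|[|[|[|[|//]]]]]] ?]; case: j => [[|[|[|[|[|[|//]]]]]] ?];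
  rewrite !mxE.
Qed.

(** The coroot is only known to be a sum of brackets. Some bracket has nonzero value under
    [alpha i], for otherwise [alpha i t] would be 0; rescaled, it gives an sl2-triple, which makes
    both root spaces lines, and the value 2 then forces its coroot to be [t]. *)
Lemma simple_triple i (t : subvs_of h) :
    vsval t \in lie_prod (root_space (alpha i)) (root_space (- alpha i)) ->
    alpha i t = 2%:R ->
  exists e f, [/\ e \in root_space (alpha i), f \in root_space (- alpha i),
                  lie e f = vsval t,
                  (root_space (alpha i) <= <[e]>)%VS &
                  (root_space (- alpha i) <= <[f]>)%VS].
Proof.
move=> tp at2; have [hS _ _] := h_cartan.
have bracket_h x y : x \in root_space (alpha i) -> y \in root_space (- alpha i) ->
    exists r : subvs_of h, lie x y = vsval r.
  move=> xb yb; have := root_space_lie xb yb; rewrite subrr => /(root_space0 h_cartan) xy.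
  by exists (Subvs xy).
have [e [f [s [ea fa efs as2]]]] : exists e f (s : subvs_of h),
    [/\ e \in root_space (alpha i), f \in root_space (- alpha i),
        lie e f = vsval s & alpha i s = 2%:R].
  pose P (p : L * L) := alpha i (vsproj h (lie p.1 p.2)) != 0.
  have [/hasP[p pin Pp]|noP] := boolP (has P
      [seq (x, y) | x <- vbasis (root_space (alpha i)), y <- vbasis (root_space (- alpha i))]).
    have /allpairsP[[x y] [/= /vbasis_mem xa /vbasis_mem ya pE]] := pin.
    have [r xyr] := bracket_h x y xa ya.
    move: Pp; rewrite /P pE /= xyr vsvalK => ar0.
    exists ((2 / alpha i r : K) *: x), y, ((2 / alpha i r : K) *: r); split=> //.
    - exact: memvZ.
    - by rewrite lieZl xyr linearZ.
    - by rewrite linearZ /= -[_ *: _]/(_ * _) divfK.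
  suff: (lie_prod (root_space (alpha i)) (root_space (- alpha i))
          <= linfun vsval @: lker (alpha i))%VS.
    move/subvP/(_ _ tp)/memv_imgP => [r]; rewrite memv_ker lfunE /= => /eqP ar0 /val_inj tr.
    by move: at2; rewrite tr ar0 => /esym/eqP; rewrite pnatr_eq0.
  apply/span_subvP => _ /allpairsP[[x y] [/= xa ya ->]].
  have [r xyr] := bracket_h x y (vbasis_mem xa) (vbasis_mem ya).
  apply/memv_imgP; exists r; last by rewrite lfunE.
  move/hasPn: noP => /(_ (x, y)) /=; rewrite /P /= xyr vsvalK negbK memv_ker; apply.
  by apply/allpairsP; exists (x, y).
have le := sl2_root_line ea fa efs as2.
have lf : (root_space (- alpha i) <= <[f]>)%VS.
  apply: (@sl2_root_line _ f e (- s)); rewrite ?opprK //.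
    by rewrite lieC efs linearN.
  by rewrite opp_lfunE linearN /= opprK.
exists e, f; split=> //; rewrite efs.
suff : (lie_prod (root_space (alpha i)) (root_space (- alpha i)) <= <[vsval s]>)%VS.
  move/subvP/(_ _ tp)/vlineP => [k tk]; suff k1 : k = 1 by rewrite tk k1 scale1r.
  have {}tk : t = k *: s by apply: val_inj; rewrite linearZ.
  have/eqP := at2; rewrite tk linearZ /= as2 -[_ *: _]/(_ * _) -[X in _ == X]mul1r.
  by rewrite (inj_eq (mulIf _)) ?pnatr_eq0 // => /eqP.
apply/lie_prod_subP => x y /(subvP le)/vlineP[a ->] /(subvP lf)/vlineP[c ->].
by rewrite lieZl linearZ /= efs !memvZ // memv_line.
Qed.

End SimpleRoots.

(* Three times the inverse of the Cartan matrix. *)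
Definition e6_inverse : seq (seq int) := [seq [seq (n : nat)%:Z | n <- r] | r <-
  [:: [:: 4; 3; 5; 6; 4; 2]; [:: 3; 6; 6; 9; 6; 3]; [:: 5; 6; 10; 12; 8; 4];
      [:: 6; 9; 12; 18; 12; 6]; [:: 4; 6; 8; 12; 10; 5]; [:: 2; 3; 4; 6; 5; 4]]%N].

Lemma e6_inverseP (k l : 'I_6) :
  \sum_(j < 6) (nth [::] e6_inverse k)`_j * e6A j l = if k == l then 3%:Z else 0.
Proof.
rewrite !big_ord_recl big_ord0.
by case: k => [[|[|[|[|[|[|//]]]]]] ?]; case: l => [[|[|[|[|[|[|//]]]]]] ?];
  vm_compute.
Qed.

Section Generators.
Variables (K : numFieldType) (L : lieAlgType K) (h : {vspace L}).
Variables (alpha : 'I_6 -> 'Hom(subvs_of h, K^o)).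
Hypothesis h_cartan : is_cartan h.
Hypothesis alpha_base : is_base alpha.

Section Coroots.
Variable T : 'I_6 -> subvs_of h.
Hypothesis alphaT : forall i j, alpha j (T i) = (e6A i j)%:~R.

(** The fundamental coweights, dual to the simple roots. *)
Definition coweight (k : 'I_6) : subvs_of h :=
  (3%:R : K)^-1 *: \sum_(j < 6) ((nth [::] e6_inverse k)`_j)%:~R *: T j.

Lemma alpha_coweight l k : alpha l (coweight k) = if k == l then 1 else 0.
Proof.
rewrite linearZ linear_sum /=; apply: (canLR (mulKf (x := 3%:R) _)).
  by rewrite pnatr_eq0.
transitivity ((\sum_(j < 6) (nth [::] e6_inverse k)`_j * e6A j l)%:~R : K).
  rewrite rmorph_sum; apply: eq_bigr => j _.
  by rewrite linearZ /= alphaT intrM.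
by rewrite e6_inverseP; case: eqP => _; rewrite ?mulr1 ?mulr0.
Qed.

Lemma cartan_span (s : subvs_of h) : s = \sum_(k < 6) (alpha k s : K) *: coweight k.
Proof.
apply/eqP; rewrite -subr_eq0; apply/eqP; apply: (base_separates alpha_base) => i.
rewrite linearB linear_sum (bigD1 i) //= linearZ /= alpha_coweight eqxx.
rewrite big1 => [|j /negPf ji]; last by rewrite linearZ /= alpha_coweight ji; apply: mulr0.
by rewrite addr0 -[_ *: 1]/(_ * 1) mulr1 subrr.
Qed.

Lemma nat_comb_coweight (c : 'I_6 -> nat) k :
  (\sum_i alpha i *+ c i) (coweight k) = (c k)%:R.
Proof.
rewrite sum_lfunE (bigD1 k) //= big1 => [|j /negPf jk].
  by rewrite addr0 -scaler_nat scale_lfunE alpha_coweight eqxx; apply: mulr1.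
by rewrite -scaler_nat scale_lfunE alpha_coweight eq_sym jk; apply: mulr0.
Qed.

(** The difference takes the values 1 and -1 on two coweights, so it is neither a positive nor a
    negative root. *)
Lemma simple_difference i j : i != j -> root_space (alpha i - alpha j) = 0%VS.
Proof.
move=> /negPf nij; apply/eqP/negPn/negP => nz.
have ne c : (c%:R : K) != -1 by rewrite -subr_eq0 opprK natr1 pnatr_eq0.
have [_ _ /(_ (alpha i - alpha j))] := alpha_base.
case.
- split=> //; apply: contraFneq nij => /lfunP/(_ (coweight i)).
  rewrite add_lfunE opp_lfunE !alpha_coweight eqxx zero_lfunE => /eqP.
  by case: (i == j) => //; rewrite oppr0 addr0 oner_eq0.
- case=> _ [c] /lfunP/(_ (coweight j)).
  rewrite nat_comb_coweight add_lfunE opp_lfunE !alpha_coweight eqxx eq_sym nij add0r.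
  by move/esym/eqP; apply/negP.
case=> _ [c] /lfunP/(_ (coweight i)).
rewrite nat_comb_coweight opp_lfunE add_lfunE opp_lfunE !alpha_coweight eqxx nij oppr0 addr0.
by move/esym/eqP; apply/negP.
Qed.

End Coroots.

Hypothesis alpha_E6 : has_cartan_matrix alpha E6_cartan.

Lemma base_generators : exists (e y : nat -> L) (T : 'I_6 -> subvs_of h),
  [/\ chevalley_generators e y (fun k => vsval (T (inord k))),
      forall i j, alpha j (T i) = (e6A i j)%:~R,
      forall i : 'I_6, e i \in root_space (alpha i) /\ (root_space (alpha i) <= <[e i]>)%VS &
      forall i : 'I_6, y i \in root_space (- alpha i)
                    /\ (root_space (- alpha i) <= <[y i]>)%VS].
Proof.
have [T HT] := fin_all_exists alpha_E6.
have AT i j : alpha j (T i) = (e6A i j)%:~R by have [_ _ ->] := HT i; rewrite E6_cartanE.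
have: forall i, exists p : L * L,
    [/\ p.1 \in root_space (alpha i), p.2 \in root_space (- alpha i),
        lie p.1 p.2 = - vsval (T i), (root_space (alpha i) <= <[p.1]>)%VS &
        (root_space (- alpha i) <= <[p.2]>)%VS].
  move=> i; have [Tp T2 _] := HT i.
  have [e [f [ea fa ef le lf]]] := simple_triple h_cartan Tp T2.
  exists (e, - f); split; rewrite ?memvN ?linearN /= ?ef //.
  by apply: subv_trans lf _; rewrite -memvE -memvN memv_line.
move/fin_all_exists => [p Hp].
exists (fun k => (p (inord k)).1), (fun k => (p (inord k)).2), T; split=> //.
- move=> i j lti ltj; set i' := inord i : 'I_6; set j' := inord j : 'I_6.
  have ii : i = i' by rewrite inordK.
  have jj : j = j' by rewrite inordK.
  have [hS _ _] := h_cartan.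
  have [ei fi efi _ _] := Hp i'; have [ej fj efj _ _] := Hp j'.
  split.
  - by apply: (cartan_abelian alpha_base hS); rewrite subvsP.
  - by rewrite (root_space_act _ ej) AT -ii -jj.
  - by rewrite (root_space_act _ fj) opp_lfunE AT -ii -jj.
  case: eqVneq => [ij|nij]; first by rewrite /i' ij -efj.
  have := root_space_lie ei fj.
  have nij' : i' != j' by rewrite -val_eqE /= -ii -jj.
  by rewrite (simple_difference AT nij') memv0 => /eqP.
- by move=> i; rewrite inord_val; have [] := Hp i.
by move=> i; rewrite inord_val; have [] := Hp i.
Qed.

End Generators.

(** * Positive root spaces are at most lines *)

Section RootSpaceSpan.
Variables (K : numFieldType) (L : lieAlgType K) (h : {vspace L}).
Variables (alpha : 'I_6 -> 'Hom(subvs_of h, K^o)) (T : 'I_6 -> subvs_of h).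
Variables (e y b : nat -> L).
Hypothesis alpha_base : is_base alpha.
Hypothesis gen : chevalley_generators e y (fun k => vsval (T (inord k))).
Hypothesis alphaT : forall i j, alpha j (T i) = (e6A i j)%:~R.
Hypothesis e_root : forall i : 'I_6, e i \in root_space (alpha i) /\
  (root_space (alpha i) <= <[e i]>)%VS.
Hypothesis y_root : forall i : 'I_6, y i \in root_space (- alpha i) /\
  (root_space (- alpha i) <= <[y i]>)%VS.
Hypothesis b_gen : forall i, (i < 6)%N ->
  [/\ b i = e i, b (36 + i)%N = vsval (T (inord i)) & b (nroot i) = y i].
Hypothesis b_act : forall i k, (i < 6)%N -> (k < 53)%N ->
  [/\ lie (e i) (b k) = ev b (tab i k),
      lie (vsval (T (inord i))) (b k) = ev b (tab (36 + i) k) &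
      lie (y i) (b k) = ev b (tab (nroot i) k)].

Lemma b_pos i k : (i < 6)%N -> (k < 36)%N ->
  [/\ lie (e i) (b k) = ev b (tab i k), lie (y i) (b k) = ev b (tab (nroot i) k) &
      lie (vsval (T (inord i))) (b k) = (coroot_pairing i (rt k))%:~R *: b k].
Proof.
move=> lti ltk; have lt53 : (k < 53)%N by apply: leq_trans ltk _.
have [-> -> ->] := b_act lti lt53; split=> //.
have /and5P[/ceqP-> _ _ _ _] := positive_checkP lti ltk.
by rewrite ev_cons ev_nil addr0.
Qed.

Lemma nat_comb_pairing c i :
  (\sum_(j < 6) alpha j *+ c j) (T i) = (coroot_pairing i (root_of c))%:~R.
Proof.
rewrite coroot_pairing_root_of sum_lfunE rmorph_sum; apply: eq_bigr => j _.
by rewrite -scaler_nat scale_lfunE alphaT /= intrM mulrC.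
Qed.

Lemma root_space_coroots (beta : 'Hom(subvs_of h, K^o)) x :
  (forall i, lie (vsval (T i)) x = (beta (T i) : K) *: x) -> x \in root_space beta.
Proof.
move=> H; apply/root_spaceP => s.
pose P s := lie (vsval s) x = (beta s : K) *: x.
have PZ a r : P r -> P (a *: r) by rewrite /P !linearZ lieZl /= -scalerA => ->.
have Psum F : (forall i : 'I_6, P (F i)) -> P (\sum_i F i).
  move=> PF; rewrite /P !linear_sum lie_suml scaler_suml.
  by apply: eq_bigr => i _; apply: PF.
rewrite -/(P s) (cartan_span alpha_base alphaT s).
by apply: (Psum) => k; apply/PZ/PZ/Psum => j; apply: PZ; apply: H.
Qed.

Lemma sum_lower c i : (0 < c i)%N ->
  \sum_(j < 6) alpha j *+ c j - alpha i = \sum_(j < 6) alpha j *+ lower c i j.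
Proof.
move=> ci; apply/eqP; rewrite subr_eq; apply/eqP.
rewrite (bigD1 i) // [in RHS](bigD1 i) //= addrAC; congr (_ + _).
  by rewrite /lower eqxx -mulrSr subn1 prednK.
by apply: eq_bigr => j /negPf ji; rewrite /lower ji subn0.
Qed.

(** Induction on the height of [c]: if [c i] and its pairing are positive, sl2 theory makes
    [lie (y i)] injective on this root space, with image in that of [lower c i]. A value of
    [wt_index c] of 36 or more means that [c] is not a root. *)
Lemma root_space_span c w : (exists j, c j != 0%N) ->
    w \in root_space (\sum_(j < 6) alpha j *+ c j) ->
  exists a : K, w = a *: (if (wt_index c < 36)%N then b (wt_index c) else 0).
Proof.
move: {2}(\sum_j c j)%N (leqnn (\sum_j c j)%N) => n.
elim: n c w => [|n IHn] c w le nz wr.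
  by case: nz => j; rewrite -leqn0 (leq_trans _ le) // (bigD1 j) //= leq_addr.
have [i ci pos] := lowerable_index nz.
have [yi _] := y_root i; have [ei ei_line] := e_root i.
have [_ tei _ eyi] := gen (ltn_ord i) (ltn_ord i).
have sl2 v : v \in root_space (\sum_(j < 6) alpha j *+ c j) -> lie (e i) (lie (y i) v) = 0 ->
    v = 0.
  move=> vr eyv; apply: (@sl2_positive_weight K L (e i) (- y i) (vsval (T i)) v
      `|coroot_pairing i (root_of c)|%N).
  - by rewrite linearN /= eyi eqxx opprK inord_val.
  - by move: tei; rewrite inord_val /e6A eqxx scaler_int.
  - by lia.
  - by rewrite (root_space_act _ vr) nat_comb_pairing -scaler_nat -[in LHS](gtz0_abs pos).
  - by rewrite lieNl linearN /= eyv oppr0.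
have yw : lie (y i) w \in root_space (\sum_(j < 6) alpha j *+ lower c i j).
  by rewrite -(sum_lower ci) addrC; apply: root_space_lie.
have [/existsP[j lj]|/existsPn low0] := boolP [exists j, lower c i j != 0%N]; last first.
  have ce j : c j = (j == i).
    have /negPn/eqP := low0 j; rewrite /lower; case: (eqVneq j i) => [->|_]; first by lia.
    by rewrite subn0.
  have sumE : \sum_(j < 6) alpha j *+ c j = alpha i.
    rewrite (bigD1 i) //= ce eqxx big1 ?addr0 // => j /negPf ji.
    by rewrite ce ji.
  rewrite (wt_index_simple ce).
  have lt36 : (i < 36)%N by apply: leq_trans (ltn_ord i) _.
  rewrite lt36; have [-> _ _] := b_gen (ltn_ord i).
  by apply/vlineP; move: wr; rewrite sumE => /(subvP ei_line).
have [a ywE] : exists a : K, lie (y i) w =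
    a *: (if (wt_index (lower c i) < 36)%N then b (wt_index (lower c i)) else 0).
  apply: IHn yw; last by exists j.
  rewrite -ltnS (leq_trans _ le) // (bigD1 i) // [in ltnRHS](bigD1 i) //=.
  rewrite -addSn leq_add //; first by rewrite /lower eqxx subn1 prednK.
  by apply: leq_sum => k _; rewrite /lower leq_subr.
have [lt'|le'] := ltnP (wt_index (lower c i)) 36; last first.
  exists 0; rewrite scale0r; apply: sl2 => //.
  by rewrite ywE ltnNge le' scaler0 linear0.
move: ywE; rewrite lt'; set k' := wt_index (lower c i) in lt' * => ywE.
have rk' : vadd (rt k') (rt i) = root_of c by rewrite /k' rt_wt_index ?root_of_lower.
have [ltk|lek] := ltnP (wt_index c) 36; last first.
  exists 0; rewrite scale0r; apply: sl2 => //.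
  rewrite ywE linearZ /=; have [-> _ _] := b_pos (ltn_ord i) lt'.
  by rewrite no_root_tab ?rk' ?ltn_ord // ev_nil scaler0.
have [z tz z0] := @lower_checkP i _ _ (ltn_ord i) ltk lt' (etrans rk' (esym (rt_wt_index ltk))).
have [_ yb Tb] := b_pos (ltn_ord i) ltk.
(* [y i] sends [b (wt_index c)] to [z] times [b k'], so with this coefficient it kills the
   difference. *)
exists (a / z%:~R); apply/eqP; rewrite -subr_eq0; apply/eqP; apply: sl2.
  rewrite memvB // memvZ //.
  apply: root_space_coroots => l; rewrite nat_comb_pairing -(rt_wt_index ltk).
  by have [_ _] := b_pos (ltn_ord l) ltk; rewrite inord_val.
rewrite linearB linearZ /= ywE yb tz ev_cons ev_nil addr0 scalerA divfK ?intr_eq0 //.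
by rewrite subrr linear0.
Qed.

End RootSpaceSpan.

(** * Freeness of the 53 vectors *)

Lemma e6_inverse_sum (K : numFieldType) (z : nat -> K) :
    (forall l, (l < 6)%N -> \sum_(c < 6) z c * (e6A c l)%:~R = 0) ->
  forall c, (c < 6)%N -> z c = 0.
Proof.
move=> H k ltk; suff: z k * 3%:R = 0.
  by move/eqP; rewrite mulf_eq0 pnatr_eq0 orbF => /eqP.
have e c : (c < 6)%N ->
    \sum_(l < 6) e6A c l * (nth [::] e6_inverse l)`_k = if c == k then 3%:Z else 0.
  move=> ltc; rewrite !big_ord_recl big_ord0.
  by move: c ltc k ltk => [|[|[|[|[|[|//]]]]]] _ [|[|[|[|[|[|//]]]]]] _; vm_compute.
transitivity (\sum_(l < 6) (\sum_(c < 6) z c * (e6A c l)%:~R)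
                * ((nth [::] e6_inverse l)`_k)%:~R); last first.
  by rewrite big1 // => l _; rewrite H ?mul0r.
under eq_bigr do rewrite big_distrl /=.
rewrite exchange_big /= (bigD1 (Ordinal ltk)) //= [X in _ + X]big1 => [|c nck].
  rewrite addr0; under eq_bigr do rewrite -mulrA -intrM.
  by rewrite -mulr_sumr -rmorph_sum /= e // eqxx.
under eq_bigr do rewrite -mulrA -intrM.
rewrite -mulr_sumr -rmorph_sum /= e // ifN ?mulr0 //.
Qed.

(* Coefficients of a regular element of the Cartan subalgebra: the 47 roots of
   the parabolic take distinct nonzero values on it. *)
Definition regular_coef : seq int :=
  Eval vm_compute in [seq dot [:: 31%:Z; 19%:Z; - 23%:Z; 6%:Z; - 5%:Z; 15%:Z] r | r <- e6_inverse].
Definition regular_value (k : nat) : int :=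
  foldr +%R 0 [seq regular_coef`_j * coroot_pairing j (rt k) | j <- iota 0 6].
(** The index 36 stands for the whole Cartan subalgebra, the eigenspace of value 0. *)
Definition eigen_idx : seq nat := Eval vm_compute in iota 0 37 ++ iota 42 11.

Lemma regular_value_inj : {in eigen_idx &, injective regular_value}.
Proof.
have H : all (fun i => all (fun j => (regular_value i == regular_value j) ==> (i == j))
  eigen_idx) eigen_idx by vm_compute.
move=> i j /(allP H)/allP/[apply]; clear H => /implyP H e; apply/eqP/H/eqP; exact: e.
Qed.

Lemma tab_weight j k : (j < 6)%N -> (k < 53)%N ->
  ceq (tab (36 + j) k) [:: (k, coroot_pairing j (rt k))].
Proof.
pose P j k := ceq (tab (36 + j) k) [:: (k, coroot_pairing j (rt k))].
have H : all (fun i => all (P i) (iota 0 53)) (iota 0 6) by vm_compute.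
by move=> ltj ltk; exact: (all2_iota H).
Qed.

Lemma regular_value_cartan k : cartan_idx k -> regular_value k = 0.
Proof.
have H : all (fun k => regular_value k == 0) (iota 36 6) by vm_compute.
by case/andP=> le lt; apply/eqP; apply: (allP_iota H).
Qed.

Definition descent_check (k : nat) : bool :=
  [|| (k < 6)%N, (36 <= k < 47)%N |
   has (fun j => if tab (if (k < 36)%N then nroot j else j) k is [:: (p, z)]
                 then [&& (p < k)%N, ~~ cartan_idx p & z != 0] else false) (iota 0 6)].

Lemma descent_checkP k : (k < 53)%N -> descent_check k.
Proof.
have H : all descent_check (iota 0 53) by vm_compute.
by move=> ltk; apply: (allP_iota H).
Qed.

Lemma eigen_idxP i : (i < 53)%N -> ~~ cartan_idx i -> i \in eigen_idx.
Proof.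
have H : all (fun i => cartan_idx i || (i \in eigen_idx)) (iota 0 53) by vm_compute.
by move=> lti /negPf nc; have := allP_iota H (leq0n _) lti; rewrite nc.
Qed.

Lemma eigen_idx_lt i : i \in eigen_idx -> (i < 53)%N.
Proof. by move: i; apply/allP; vm_compute. Qed.

Section Freeness.
Variables (K : numFieldType) (L : lieAlgType K) (e y t b : nat -> L).
Hypothesis gen : chevalley_generators e y t.
Hypothesis t_free : forall z : nat -> K, \sum_(c < 6) z c *: t c = 0 ->
  forall c, (c < 6)%N -> z c = 0.
Hypothesis b_gen : forall i, (i < 6)%N ->
  [/\ b i = e i, b (36 + i)%N = t i & b (nroot i) = y i].
Hypothesis b_act : forall i k, (i < 6)%N -> (k < 53)%N ->
  [/\ lie (e i) (b k) = ev b (tab i k), lie (t i) (b k) = ev b (tab (36 + i) k) &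
      lie (y i) (b k) = ev b (tab (nroot i) k)].

(** Brackets with generators lead from [b k] down to some [e i] or [y i], nonzero because their
    bracket is [- t i]. *)
Lemma root_vector_neq0 k : (k < 53)%N -> ~~ cartan_idx k -> b k != 0.
Proof.
have tn0 i : (i < 6)%N -> t i != 0.
  move=> lti; apply/eqP => t0; have := t_free (z := fun j => (i == j)%:R).
  move/(_ _ i lti); rewrite eqxx => H; suff /eqP : (1 : K) = 0 by rewrite oner_eq0.
  apply: H; rewrite big1 // => c _; case: eqP => [<-|_]; first by rewrite t0 scaler0.
  by rewrite scale0r.
elim/ltn_ind: k => k IHk ltk nc; have := descent_checkP ltk; rewrite /descent_check; case/or3P.
- move=> lti; have [-> _ _] := b_gen lti; have [_ _ _] := gen lti lti; rewrite eqxx.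
  by move=> E; apply: contraNneq (tn0 k lti) => e0; rewrite -oppr_eq0 -E e0 lie0l.
- move=> /andP[le36 lt47]; have [j ltj ->] : exists2 j, (j < 6)%N & k = nroot j.
    by apply: gen_nroot; rewrite lt47 andbT leqNgt; apply: contra nc => ?; apply/andP.
  have [_ _ ->] := b_gen ltj; have [_ _ _] := gen ltj ltj; rewrite eqxx.
  by move=> E; apply: contraNneq (tn0 j ltj) => e0; rewrite -oppr_eq0 -E e0 linear0.
case/hasP=> j; rewrite mem_iota => /= ltj.
have [eb _ yb] := b_act ltj ltk.
set g := (X in tab X k); case tE: (tab g k) => [|[p z] [|? ?]] // /and3P[ltp ncp z0].
have : ev b (tab g k) != 0.
  rewrite tE ev_cons ev_nil addr0 scaler_eq0 intr_eq0 negb_or z0 IHk //.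
  exact: ltn_trans ltk.
apply: contraNneq => b0; rewrite /g; case: ifP => _; [rewrite -yb | rewrite -eb];
  by rewrite b0 linear0.
Qed.

(** A regular element splits a relation into single root vectors, which are nonzero, and a Cartan
    part, to which [t_free] applies. *)
Lemma table_free : free (mkseq b 53).
Proof.
apply: free_mkseqP => z sum0.
pose v i := if cartan_idx i then \sum_(c < 6) z (36 + c)%N *: b (36 + c)%N else z i *: b i.
pose s := \sum_(j < 6) (regular_coef`_j)%:~R *: t j.
have sb k : (k < 53)%N -> lie s (b k) = (regular_value k)%:~R *: b k.
  move=> ltk; rewrite lie_suml /regular_value foldrE big_map rmorph_sum scaler_suml.
  rewrite -[iota 0 6]/(index_iota 0 6) big_mkord; apply: eq_bigr => j _.
  have [_ tb _] := b_act (ltn_ord j) ltk.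
  by rewrite lieZl tb (ceqP _ (tab_weight (ltn_ord j) ltk)) ev_cons ev_nil addr0 /= intrM scalerA.
have v0 : forall i, i \in eigen_idx -> v i = 0.
  apply: (@eigen_sum0 _ _ (lie s) nat eigen_idx (fun k => (regular_value k)%:~R) v).
  - by vm_compute.
  - by move=> i1 i2 h1 h2 /eqP; rewrite eqr_int => /eqP; apply: regular_value_inj.
  - move=> k /eigen_idx_lt ltk; rewrite /v /=; case: ifP => ck.
      rewrite regular_value_cartan // scale0r linear_sum big1 // => c _.
      have lt42 : (36 + c < 42)%N by rewrite -[42%N]/(36 + 6)%N ltn_add2l.
      have c36 : cartan_idx (36 + c) by rewrite /cartan_idx leq_addr.
      have sc : lie s (b (36 + c)%N) = 0.
        by rewrite sb ?regular_value_cartan ?scale0r //; apply: ltn_trans lt42 _.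
      by rewrite linearZ /= sc scaler0.
    by rewrite linearZ /= sb // !scalerA mulrC.
  rewrite -[RHS]sum0 -(big_mkord xpredT (fun i => z i *: b i)).
  rewrite -[eigen_idx]/(iota 0 36 ++ [:: 36%N] ++ iota 42 11).
  rewrite -[index_iota 0 53]/(iota 0 36 ++ iota 36 6 ++ iota 42 11).
  rewrite !big_cat3; congr (_ + (_ + _)).
  - rewrite !big_seq; apply: eq_bigr => i; rewrite mem_iota /v /cartan_idx => /andP[_ lt].
    by rewrite leqNgt lt.
  - by rewrite big_seq1 {1}/v (iotaDl 36 0 6) big_map -[iota 0 6]/(index_iota 0 6) big_mkord.
  rewrite !big_seq; apply: eq_bigr => i; rewrite mem_iota /v /cartan_idx => /andP[le _].
  by rewrite [(i < 42)%N]ltnNge le andbF.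
move=> i lti; have [ci|nc] := boolP (cartan_idx i); last first.
  have /eqP := v0 i (eigen_idxP lti nc).
  by rewrite /v (negPf nc) scaler_eq0 (negPf (root_vector_neq0 lti nc)) orbF => /eqP.
have /andP[le36 lt42] := ci; rewrite -(subnKC le36).
apply: (t_free (z := fun c => z (36 + c)%N)); last by rewrite -(ltn_add2l 36) subnKC.
rewrite -[RHS](v0 36%N isT); apply: eq_bigr => c _.
by have [_ -> _] := b_gen (ltn_ord c).
Qed.

End Freeness.

(** * A basis of the parabolic subalgebra *)

Definition e6_frame (K : fieldType) (L : lieAlgType K) (b : nat -> L) : Prop :=
  basis_of fullv (mkseq b 53) /\
  forall i j, (i < 53)%N -> (j < 53)%N -> lie (b i) (b j) = ev b (tab i j).

Lemma ev_memv (K : fieldType) (V : vectType K) (b : nat -> V) (U : {vspace V}) s :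
  {in unzip1 s, forall i, b i \in U} -> ev b s \in U.
Proof.
move=> bU; rewrite /ev big_seq memv_suml // => p sp.
by rewrite memvZ // bU // map_f.
Qed.

Lemma nroot_lt53 i : (i < 6)%N -> i != 4 -> (nroot i < 53)%N.
Proof.
have H : all (fun i => (i != 4) ==> (nroot i < 53)%N) (iota 0 6) by vm_compute.
by move=> lti ni; have := allP_iota H (leq0n _) lti; rewrite ni.
Qed.

Lemma gen_nroot4 i : (42 <= i < 47)%N -> exists j, [/\ (j < 6)%N, j != 4 & i = nroot j].
Proof.
have H : all (fun i => i \in [seq nroot i | i <- [:: 0; 1; 2; 3; 5]]%N) (iota 42 5) by vm_compute.
case/andP=> le lt; have /mapP[j hj ->] := allP_iota H le lt.
by exists j; move: hj; rewrite !inE => /or4P[/eqP->|/eqP->|/eqP->|/orP[]/eqP->].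
Qed.

Definition parabolic_nodes : {set 'I_6} := [set i : 'I_6 | bourbaki i \in [:: 1; 2; 3; 4; 6]%N].

Lemma parabolic_nodesE i : (i \in parabolic_nodes) = (val i != 4).
Proof. by rewrite inE; case: i => [[|[|[|[|[|[|//]]]]]] ?]. Qed.

Section ParabolicFrame.
Variables (K : numFieldType) (L : lieAlgType K) (np h nm : {vspace L}).
Variable (alpha : 'I_6 -> 'Hom(subvs_of h, K^o)).
Hypothesis triang : triangular_decomposition np nm alpha.
Hypothesis alpha_E6 : has_cartan_matrix alpha E6_cartan.
Let p := std_parabolic np alpha parabolic_nodes.

(** The 53 vectors are iterated brackets of generators lying in [p]; conversely their span is a
    subalgebra which, by the bound on root spaces, contains the subspaces generating [p]. *)
Lemma parabolic_frame : exists b : nat -> subalg_type p, e6_frame b.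
Proof.
have [h_cartan alpha_base [np_root np_min] _ _] := triang.
have [e [y [T [gen alphaT e_root y_root]]]] := base_generators h_cartan alpha_base alpha_E6.
have [b [b_gen b_act b_tab]] := parabolic_table gen.
have t_free (z : nat -> K) : \sum_(c < 6) z c *: vsval (T (inord c)) = 0 ->
    forall c, (c < 6)%N -> z c = 0.
  move=> sum0; apply: e6_inverse_sum => l ltl.
  have : alpha (Ordinal ltl) (\sum_(c < 6) z c *: T c) = 0.
    rewrite [X in alpha _ X](_ : _ = 0) ?linear0 //; apply: val_inj.
    rewrite /= linear_sum -[RHS]sum0; apply: eq_bigr => c _.
    by rewrite linearZ inord_val.
  rewrite linear_sum => E; rewrite -[RHS]E; apply: eq_bigr => c _.
  by rewrite linearZ /= alphaT.
have bfree : free (mkseq b 53) := table_free gen t_free b_gen b_act.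
have alpha_pos i : positive_root alpha (alpha i).
  have [_ /(_ i) ri _] := alpha_base; split=> //; exists (fun j => nat_of_bool (j == i)).
  rewrite (bigD1 i) //= eqxx big1 ?addr0 // => j /negPf ->; exact: mulr0n.
pose U := (h + np + \sum_(i in parabolic_nodes) root_space (- alpha i))%VS.
have Up : (U <= p)%VS by apply: lie_gen_subv.
have e_in i : (i < 6)%N -> b i \in p.
  move=> lti; have [-> _ _] := b_gen i lti; apply: (subvP Up).
  have [ei _] := e_root (Ordinal lti).
  apply: (subvP (addvSl _ _)); apply: (subvP (addvSr _ _)).
  exact: (subvP (np_root _ (alpha_pos (Ordinal lti))) _ ei).
have t_in i : (i < 6)%N -> b (36 + i)%N \in p.
  move=> lti; have [_ -> _] := b_gen i lti; apply: (subvP Up).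
  apply: (subvP (addvSl _ _)); apply: (subvP (addvSl _ _)); exact: subvsP.
have y_in i : (i < 6)%N -> i != 4 -> b (nroot i) \in p.
  move=> lti ni; have [_ _ ->] := b_gen i lti; apply: (subvP Up).
  have [yi _] := y_root (Ordinal lti); apply: (subvP (addvSr _ _)).
  apply: (subvP (sumv_sup (Ordinal lti) _ (subvv _)) _ yi); by rewrite parabolic_nodesE.
have b_in i : (i < 53)%N -> b i \in p.
  elim/ltn_ind: i => i IHi lti; have [gi|ngi] := boolP (gen_idx i).
    case/or3P: gi => [/e_in //|/andP[le36 lt42]|/gen_nroot4[j [ltj nj ->]]]; last exact: y_in.
    by rewrite -(subnKC le36) t_in // -(ltn_add2l 36) subnKC.
  have [g [q [z]]] := step_checkP lti ngi; rewrite /step_check.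
  case/and5P=> gg ltg ltq /eqP zz /andP[/eqP tgp _].
  have ltq53 : (q < 53)%N by apply: ltn_trans lti.
  have gp : b g \in p.
    case/or3P: gg => [/e_in //|/andP[le36 lt42]|/gen_nroot4[j [ltj nj ->]]]; last exact: y_in.
    by rewrite -(subnKC le36) t_in // -(ltn_add2l 36) subnKC.
  have -> : b i = z%:~R *: lie (b g) (b q).
    by rewrite b_tab // tgp ev_cons ev_nil addr0 scalerA -intrM zz scale1r.
  by rewrite memvZ // (subalgP (s := p)) // IHi.
pose B := <<mkseq b 53>>%VS.
have bB i : (i < 53)%N -> b i \in B.
  by move=> lti; apply: memv_span; apply/mapP; exists i; rewrite ?mem_iota.
have BS : is_subalgebra B.
  suff : (lie_prod B B <= B)%VS by move=> /lie_prod_subP H x w xB wB; apply: H.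
  apply/lie_prod_subP => x w xB wB.
  have sub (f : {linear L -> L}) v :
      v \in B -> (forall i, (i < 53)%N -> f (b i) \in B) -> f v \in B.
    move=> vB Hf; have : (linfun f @: B <= B)%VS.
      rewrite limg_span; apply/span_subvP => _ /mapP[_ /mapP[i + ->] ->].
      by rewrite mem_iota lfunE /= => lti; apply: Hf.
    by move/subvP; apply; rewrite -(lfunE f) memv_img.
  apply: (sub (lie x)) => // j ltj /=; rewrite lieC memvN.
  apply: (sub (lie (b j))) => // i lti /=; rewrite b_tab //.
  apply: ev_memv => _ /mapP[q qin ->]; apply: bB.
  exact: (allP (tab_closed ltj lti)) _ qin.
have pB : (p <= B)%VS.
  apply: lie_gen_min BS _; rewrite !subv_add -andbA; apply/and3P; split.
  - apply/subvP => s sh; have -> : s = vsval (Subvs sh) by [].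
    rewrite (cartan_span alpha_base alphaT (Subvs sh)) linear_sum memv_suml // => k _.
    rewrite linearZ memvZ // linearZ memvZ // linear_sum memv_suml // => j _.
    rewrite linearZ memvZ //= -[j]inord_val; have [_ <- _] := b_gen j (ltn_ord j).
    by apply: bB; apply: (@leq_trans 42) => //; rewrite -[42%N]/(36 + 6)%N ltn_add2l.
  - apply: np_min => beta [[nz _] [c bc]]; apply/subvP => w wb.
    have cn0 : exists j, c j != 0%N.
      apply/existsP; apply: contraNT nz => /existsPn c0; rewrite bc big1 // => j _.
      by rewrite (eqP (negbNE (c0 j))) mulr0n.
    rewrite bc in wb.
    have [a ->] := root_space_span alpha_base gen alphaT e_root y_root b_gen b_act cn0 wb.
    rewrite memvZ //; case: ifP => lt; last exact: mem0v.
    by apply: bB; apply: leq_trans lt _.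
  apply/subv_sumP => i; rewrite parabolic_nodesE => ni.
  have [_ yl] := y_root i; apply: subv_trans yl _; rewrite -memvE.
  by have [_ _ <-] := b_gen i (ltn_ord i); apply: bB; apply: nroot_lt53.
exists (fun i => vsproj p (b i)); split.
  rewrite basisEfree; apply/and3P; split.
  - apply: free_mkseqP => z sum0 i lti.
    apply: (free_mkseq_sum0 bfree) lti; rewrite -[RHS](congr1 vsval sum0) linear_sum.
    by apply: eq_bigr => j _; rewrite linearZ /= vsprojK // b_in.
  - exact: subvf.
  rewrite size_mkseq dimvf [X in (X <= _)%N]/(\dim p).
  by rewrite (leq_trans (dimvS pB)) // (leq_trans (dim_span _)) ?size_mkseq.
move=> i j lti ltj; apply: val_inj; rewrite /= !vsprojK ?b_in // b_tab //.
rewrite /ev linear_sum /= !big_seq; apply: eq_bigr => q qin.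
rewrite [vsval _]vsprojK // b_in //; exact: (allP (tab_closed lti ltj)) _ qin.
Qed.

End ParabolicFrame.

(** * Stabilizers of linear forms *)

Lemma semisimple_nilpotent (K : fieldType) (V : vectType K) (u : 'End(V)) n :
  semisimple_endo u -> (forall v, iter n u v = 0) -> u = 0.
Proof.
case=> b /andP[/eqP b_span _] eig un0; apply/lfunP => v; rewrite zero_lfunE.
have : (fullv <= lker u)%VS.
  rewrite -b_span; apply/span_subvP => w wb; rewrite memv_ker.
  have [k uw] := eig w wb; have := un0 w.
  have -> : iter n u w = k ^+ n *: w.
    elim: n {un0} => [|n IHn]; first by rewrite expr0 scale1r.
    by rewrite iterS IHn linearZ /= uw scalerA exprSr.
  move/eqP; rewrite scaler_eq0 expf_eq0 => /orP[/andP[_ /eqP k0]|/eqP->].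
    by rewrite uw k0 scale0r.
  by rewrite linear0.
by move/subvP/(_ v (memvf v)); rewrite memv_ker => /eqP.
Qed.

Lemma ad_lie (K : fieldType) (L : lieAlgType K) (x y : L) :
  lie (ad x) (ad y) = ad (lie x y).
Proof.
apply/lfunP => z; rewrite [LHS]gl_lieE !adE lie_der.
by rewrite addrK.
Qed.

(** * Filtrations and forms of reductive type *)

Section Filtration.
Variables (K : fieldType) (L : lieAlgType K) (Fil : int -> {vspace L}).
Hypothesis Fil_lie : forall i j x y, x \in Fil i -> y \in Fil j -> lie x y \in Fil (i + j).
Hypothesis Fil_anti : forall i j, i <= j -> (Fil j <= Fil i)%VS.
Variable M : nat.
Hypothesis Fil_top : forall x, x \in Fil (- M%:Z).
Hypothesis Fil_bot : Fil (M.+1)%:Z = 0%VS.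
Hypothesis ad_inj : forall x : L, ad x = 0 -> x = 0.

(* S /\ Fil 1 is a nilpotent ideal of S = L(f); were f of reductive type, its
   elements would be central, hence both ad-semisimple and ad-nilpotent. *)
Lemma filtered_not_reductive_type (f : 'Hom(L, K^o)) x :
  (stab f <= Fil 0)%VS -> x \in stab f -> x \in Fil 1 -> x != 0 -> ~ reductive_type f.
Proof.
move=> S0 xS x1 nzx [[_ _ radical] ss].
pose S := stab f; pose I k := (ad @: (S :&: Fil k))%VS.
have S_lie y z : y \in S -> z \in S -> lie y z \in S.
  move=> /stabP yS /stabP zS; apply/stabP => w.
  have -> : lie (lie y z) w = lie y (lie z w) - lie z (lie y w) by rewrite lie_der addrK.
  by rewrite linearB /= yS zS subrr.
have I_lie i j u v : u \in I i -> v \in I j -> lie u v \in I (i + j).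
  move=> /memv_imgP[y + ->] /memv_imgP[z + ->]; rewrite !memv_cap.
  move=> /andP[yS yi] /andP[zS zj]; rewrite ad_lie memv_img // memv_cap S_lie //.
  exact: Fil_lie.
have I_anti i j : i <= j -> (I j <= I i)%VS.
  by move=> ij; apply: limgS; apply: capvS; [exact: subvv | exact: Fil_anti].
have idI : is_ideal (ad @: S)%VS (I 1).
  split=> [|u v /memv_imgP[y yS ->]]; first by apply: limgS; exact: capvSl.
  rewrite -[1](add0r 1); apply: I_lie; rewrite memv_img // memv_cap yS.
  exact: (subvP S0).
have solI : solvable (I 1).
  (* The n-th derived algebra of [I 1] lies in [I (n + 1)]. *)
  exists M; apply/eqP; rewrite -subv0; apply: (@subv_trans _ _ (I (M.+1)%:Z)).
    elim: M => [|n IHn]; first exact: subvv.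
    apply/lie_prod_subP => u v /(subvP IHn) uI /(subvP IHn) vI.
    by apply: (subvP (I_anti _ _ _)) (I_lie _ _ _ _ uI vI); lia.
  by rewrite /I Fil_bot capv0 limg0.
have adxZ : ad x \in center (ad @: S)%VS.
  by apply: (subvP (radical _ idI solI)); rewrite memv_img // memv_cap xS.
have xn n k z : z \in Fil k -> iter n (ad x) z \in Fil (k + n%:Z).
  move=> zk; elim: n => [|n IHn]; first by rewrite addr0.
  rewrite iterS adE; have := Fil_lie x1 IHn; congr (_ \in Fil _).
  by rewrite -addn1 PoszD; ring.
move/eqP: nzx; apply; apply: ad_inj.
(* Degrees run from -M to M, so 2M + 1 applications of [ad x] kill every vector. *)
apply: (@semisimple_nilpotent _ _ _ (M + M).+1) (ss _ adxZ) _ => z.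
apply/eqP; rewrite -memv0 -Fil_bot.
by have := xn (M + M).+1 _ _ (Fil_top z); congr (_ \in Fil _); lia.
Qed.

End Filtration.

(** * Frames: trivial center and gradings *)

Lemma has_pairing k : (k < 53)%N -> ~~ cartan_idx k ->
  exists2 j, (j < 6)%N & coroot_pairing j (rt k) != 0.
Proof.
have H : all (fun k => cartan_idx k || has (fun j => coroot_pairing j (rt k) != 0) (iota 0 6))
  (iota 0 53) by vm_compute.
move=> ltk /negPf nc; have := allP_iota H (leq0n _) ltk; clear H; rewrite nc orFb.
by case/hasP=> j; rewrite mem_iota => ltj ne; exists j.
Qed.

Lemma tab_simple_cartan j c : (j < 6)%N -> (c < 6)%N ->
  ceq (tab (36 + c) j) [:: (j, e6A c j)].
Proof.
pose P j c := ceq (tab (36 + c) j) [:: (j, e6A c j)].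
have H : all (fun j => all (P j) (iota 0 6)) (iota 0 6) by vm_compute.
by move=> ltj ltc; exact: (all2_iota H).
Qed.


Section Frames.
Variables (K : numFieldType) (L : lieAlgType K).
Implicit Types (b : nat -> L) (f : 'Hom(L, K^o)).

Lemma frame_sum0 b (z : nat -> K) : e6_frame b ->
  \sum_(i < 53) z i *: b i = 0 -> forall i, (i < 53)%N -> z i = 0.
Proof. by case=> /basis_free bfree _; exact: free_mkseq_sum0. Qed.

Lemma frame_coord b x : e6_frame b -> exists z : nat -> K, x = \sum_(i < 53) z i *: b i.
Proof.
case=> bb _; have sz : size (mkseq b 53) == 53 by rewrite size_mkseq.
have xs : x \in <<Tuple sz>>%VS by case/andP: bb => /eqP /= ->; rewrite memvf.
exists (fun i => if insub i is Some j then coord (Tuple sz) j x else 0).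
rewrite [LHS](coord_span xs); apply: eq_bigr => i _.
by rewrite valK nth_mkseq.
Qed.

Lemma frame_cartan_act b j k : e6_frame b -> (j < 6)%N -> (k < 53)%N ->
  lie (b (36 + j)%N) (b k) = (coroot_pairing j (rt k))%:~R *: b k.
Proof.
case=> _ tabE ltj ltk; rewrite tabE //; last first.
  by apply: (@leq_trans 42) => //; rewrite -[42%N]/(36 + 6)%N ltn_add2l.
by rewrite (ceqP _ (tab_weight ltj ltk)) ev_cons ev_nil addr0.
Qed.

(** Brackets with coroots kill the root components, each root being nonzero on some coroot; brackets
    with simple root vectors kill the Cartan component, the Cartan matrix being invertible. *)
Lemma frame_ad_inj b (x : L) : e6_frame b -> ad x = 0 -> x = 0.
Proof.
move=> fb ad0; have x0 y : lie x y = 0 by rewrite -adE ad0 zero_lfunE.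
have [z xE] := frame_coord x fb.
have zroot k : (k < 53)%N -> ~~ cartan_idx k -> z k = 0.
  move=> ltk /(has_pairing ltk)[j ltj ne].
  have : z k * (coroot_pairing j (rt k))%:~R = 0.
    apply: (frame_sum0 (z := fun k => z k * (coroot_pairing j (rt k))%:~R) fb) => //.
    have E : lie (b (36 + j)%N) x = 0 by rewrite lieC x0 oppr0.
    rewrite -[RHS]E xE linear_sum; apply: eq_bigr => i _.
    by rewrite linearZ /= frame_cartan_act // scalerA.
  by move/eqP; rewrite mulf_eq0 intr_eq0 (negPf ne) orbF => /eqP.
have zcartan : forall c, (c < 6)%N -> z (36 + c)%N = 0.
  apply: (@e6_inverse_sum _ (fun c => z (36 + c)%N)) => l ltl.
  have lt53 : (l < 53)%N by apply: leq_trans ltl _.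
  suff E : (\sum_(c < 6) z (36 + c)%N * (e6A c l)%:~R) *: b l = 0.
    pose zl i := if i == l then \sum_(c < 6) z (36 + c)%N * (e6A c l)%:~R else 0.
    have := frame_sum0 (z := zl) fb _ lt53; rewrite /zl eqxx; apply; rewrite (bigD1 (Ordinal lt53)) //=.
    rewrite eqxx E add0r big1 // => i il.
    by rewrite ifN ?scale0r.
  rewrite -[RHS](x0 (b l)) xE lie_suml scaler_suml.
  rewrite -(big_mkord xpredT (fun c => (z (36 + c)%N * (e6A c l)%:~R) *: b l)).
  rewrite -(big_mkord xpredT (fun i => lie (z i *: b i) (b l))).
  have cut (F : nat -> L) : (forall i, (i < 53)%N -> ~~ cartan_idx i -> F i = 0) ->
      \sum_(0 <= i < 53) F i = \sum_(0 <= c < 6) F (36 + c)%N.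
    move=> F0; rewrite -[index_iota 0 53]/(iota 0 36 ++ iota 36 6 ++ iota 42 11).
    have z1 : \sum_(i <- iota 0 36) F i = 0.
      rewrite big1_seq // => i /andP[_]; rewrite mem_iota => /andP[_ lt36].
      by apply: F0; [exact: leq_trans lt36 _ | rewrite /cartan_idx leqNgt lt36].
    have z2 : \sum_(i <- iota 42 11) F i = 0.
      rewrite big1_seq // => i /andP[_]; rewrite mem_iota => /andP[le42 i53].
      by apply: F0 => //; rewrite /cartan_idx [(i < 42)%N]ltnNge le42 andbF.
    rewrite big_cat3 z1 z2 add0r addr0.
    by rewrite (iotaDl 36 0 6) big_map -[iota 0 6]/(index_iota 0 6).
  rewrite cut; last by move=> i lti nc; rewrite zroot // scale0r lie0l.
  rewrite !big_mkord; apply: eq_bigr => c _; rewrite lieZl; case: fb => _ tabE.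
  have ltc : (36 + c < 53)%N.
    by apply: (@leq_trans 42) => //; rewrite -[42%N]/(36 + 6)%N ltn_add2l.
  by rewrite tabE // (ceqP _ (tab_simple_cartan ltl (ltn_ord c))) ev_cons ev_nil addr0 scalerA.
rewrite xE big1 // => i _; have [/andP[le36 lt42]|nc] := boolP (cartan_idx i).
  by rewrite -(subnKC le36) zcartan ?scale0r // -(ltn_add2l 36) subnKC.
by rewrite zroot ?scale0r.
Qed.

Definition filtration b (w : nat -> int) (k : int) : {vspace L} :=
  <<[seq b i | i <- iota 0 53 & (k <= w i)%R]>>%VS.

Definition graded (w : nat -> int) : Prop :=
  forall i j p, (i < 53)%N -> (j < 53)%N -> p \in tab i j -> w p.1 = w i + w j.

Lemma filtration_mem b w k i : (i < 53)%N -> k <= w i -> b i \in filtration b w k.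
Proof.
by move=> lti le; apply/memv_span/map_f; rewrite mem_filter le mem_iota.
Qed.

Lemma span_linear (V : vectType K) (s : seq L) (U : {vspace V}) (u : {linear L -> V}) x :
  x \in <<s>>%VS -> {in s, forall v, u v \in U} -> u x \in U.
Proof.
move=> xs su; have : (linfun u @: <<s>> <= U)%VS.
  by rewrite limg_span; apply/span_subvP => _ /mapP[v vs ->]; rewrite lfunE; exact: su.
by move/subvP; apply; rewrite -(lfunE u) memv_img.
Qed.

Lemma filtration_lie b w : e6_frame b -> graded w -> forall i j x y,
  x \in filtration b w i -> y \in filtration b w j -> lie x y \in filtration b w (i + j).
Proof.
move=> [_ tabE] gw i j x y xi yj.
apply: (span_linear (u := lie x) yj) => _ /mapP[l + ->].
rewrite mem_filter mem_iota => /andP[jl /= ltl] /=.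
rewrite lieC memvN.
apply: (span_linear (u := lie (b l)) xi) => _ /mapP[k + ->].
rewrite mem_filter mem_iota => /andP[ik /= ltk] /=.
rewrite (tabE _ _ ltl ltk); apply: ev_memv => _ /mapP[p pin ->].
apply: filtration_mem; first exact: (allP (tab_closed ltl ltk)) _ pin.
by rewrite (gw l k p ltl ltk pin) addrC lerD.
Qed.

Lemma graded_not_reductive_type b w f x : e6_frame b -> graded w ->
  (stab f <= filtration b w 0)%VS -> x \in stab f -> x \in filtration b w 1 -> x != 0 ->
  ~ reductive_type f.
Proof.
move=> fb gw; pose M := (\sum_(i < 53) `|w i|)%N.
have wM i : (i < 53)%N -> (`|w i| <= M)%N.
  by move=> lti; rewrite /M (bigD1 (Ordinal lti)) //= leq_addr.
apply: (@filtered_not_reductive_type _ _ (filtration b w) _ _ M).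
- exact: filtration_lie.
- move=> i j ij; apply: sub_span => v /mapP[k + ->]; rewrite mem_filter => /andP[jk ltk].
  by apply: map_f; rewrite mem_filter (le_trans ij).
- move=> v; have [z ->] := frame_coord v fb; rewrite memv_suml // => i _.
  by rewrite memvZ // filtration_mem //; have := wM i (ltn_ord i); lia.
- rewrite /filtration (_ : [seq i <- _ | _] = [::]) ?span_nil //.
  apply/eqP; rewrite -(negbK (_ == _)) -has_filter; apply/hasPn => i; rewrite mem_iota => lti.
  by have := wM i lti; lia.
by move=> v; exact: (frame_ad_inj fb).
Qed.

End Frames.

(** * Exponentials of nilpotent inner derivations *)

Section Exponential.
Variables (K : numFieldType) (L : lieAlgType K).

Definition exp2 (n : L) : 'End(L) := (\1 + ad n + 2%:R^-1 *: (ad n \o ad n))%VF.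

Lemma exp2E n x : exp2 n x = x + lie n x + 2%:R^-1 *: lie n (lie n x).
Proof. by rewrite !add_lfunE id_lfunE scale_lfunE comp_lfunE !adE. Qed.

Lemma half_scaler (v : L) : 2%:R^-1 *: v + 2%:R^-1 *: v = v.
Proof. by rewrite -scalerDl -[X in (X + X) *: _]mul1r -splitr scale1r. Qed.

Variable n : L.
Hypothesis n3 : forall x, lie n (lie n (lie n x)) = 0.

Lemma exp2_lie x y : lie (exp2 n x) (exp2 n y) = exp2 n (lie x y).
Proof.
have D u v : lie n (lie u v) = lie (lie n u) v + lie u (lie n v) by exact: lie_der.
have d2 u v : lie n (lie n (lie u v)) =
    lie (lie n (lie n u)) v + (lie (lie n u) (lie n v) + lie (lie n u) (lie n v))
    + lie u (lie n (lie n v)).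
  by rewrite [lie n (lie u v)]D linearD /= (D (lie n u)) (D u) !addrA.
(* By the Leibniz rule, three times this sum is [(ad n)^3 [u, v]]. *)
have c3 u v : lie (lie n (lie n u)) (lie n v) + lie (lie n u) (lie n (lie n v)) = 0.
  have := n3 (lie u v); rewrite (d2 u v) !linearD /=.
  rewrite (D _ v) (D (lie n u)) (D u) !n3 lie0l linear0 add0r addr0.
  rewrite addrAC -mulr2n -mulrS => /eqP.
  by rewrite -scaler_nat scaler_eq0 pnatr_eq0 => /eqP.
(* Applying [ad n] to [c3] gives twice this bracket. *)
have c4 u v : lie (lie n (lie n u)) (lie n (lie n v)) = 0.
  have := congr1 (lie n) (c3 u v); rewrite linearD /= (D _ (lie n v)) (D (lie n u)).
  rewrite !n3 lie0l !linear0 add0r addr0.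
  by rewrite -mulr2n => /eqP; rewrite -scaler_nat scaler_eq0 pnatr_eq0 => /eqP.
have /eqP := c3 x y; rewrite addrC addr_eq0 => /eqP c3'.
rewrite !exp2E (d2 x y) [lie n (lie x y)]D !lieDl !linearD /=.
rewrite !lieZl !linearZ /= c4 c3' !scaler0 addr0.
rewrite scalerN !addrA [LHS](ACl (1*4*2*7*5*3*(6*8)))/= addNr addr0.
by rewrite [RHS](ACl (1*2*3*4*(5*6)*7))/= half_scaler.
Qed.

Lemma exp2K : (exp2 (- n) \o exp2 n)%VF = \1%VF.
Proof.
apply/lfunP => x; rewrite comp_lfunE id_lfunE !exp2E !lieNl !linearN /= !opprK.
rewrite !linearD !linearZ /= !n3. rewrite ?linear0 ?scaler0 ?addr0 !addrA.
by rewrite [LHS](ACl (1*(2*4)*((3*6)*5)))/= half_scaler !subrr !addr0.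
Qed.

Lemma exp2_frame b : e6_frame b -> e6_frame (fun j => exp2 n (b j)).
Proof.
move=> fb; have [bb tabE] := fb; split.
  rewrite basisEfree; apply/and3P; split; last 2 first.
  - exact: subvf.
  - by have /andP[/eqP <- _] := bb; rewrite (leq_trans (dim_span _)) // !size_mkseq.
  apply: free_mkseqP => z sum0 i lti; apply: (frame_sum0 fb) lti.
  have E : exp2 n (\sum_(j < 53) z j *: b j) = 0.
    by rewrite -[RHS]sum0 linear_sum; apply: eq_bigr => j _; rewrite linearZ.
  have := congr1 (exp2 (- n)) E; rewrite linear0 -comp_lfunE exp2K id_lfunE //.
move=> i j lti ltj; rewrite exp2_lie tabE // /ev linear_sum.
by apply: eq_bigr => p _; rewrite linearZ.
Qed.

End Exponential.

(** * Certificates for linear forms *)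

Definition dead (Z : seq nat) (s : comb) : bool := all (fun p => p.1 \in Z) s.
Definition live (Z : seq nat) (s : comb) : comb := [seq p <- s | p.1 \notin Z].
Definition second_comb (i j : nat) : comb := tab_comb i (tab i j).
Definition ad_cube_zero (i : nat) : bool :=
  all (fun j => ceq (tab_comb i (second_comb i j)) [::]) (iota 0 53).
(** Ensures that exp (s ad b_i) leaves f (b_j) unchanged: [f] kills the terms of order one and
    two. *)
Definition preserved (Z : seq nat) (i j : nat) : bool :=
  [&& (j < 53)%N, dead Z (tab i j) & dead Z (second_comb i j)].

(* A strategy shows that no linear form f is of reductive type, given which
   coordinates f (b i) are known to vanish (Z) or not to vanish (NZ) in the current
   basis b.  [Clear i k] replaces b by exp (s ad b_i) b, with s chosen so that
   f (b k) becomes 0; [Swap i k j] does it with s = 1, so that the nonzero f (b j) is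
   added to the zero f (b k); [Branch k] distinguishes whether f (b k) is zero.
   [Leaf d elim J] concludes with the grading d of the simple roots: each pair
   (i, j) of elim shows, pairing with b_j, that elements of the stabilizer have no
   component on b_i; and more unknowns (J) than equations yield a nonzero element
   of positive degree in the stabilizer. *)
Inductive strategy : Type :=
| Leaf (d : seq int) (elim : seq (nat * nat)) (J : seq nat)
| Goto (m : nat)
| Clear (i k : nat) (t : strategy)
| Swap (i k j : nat) (t : strategy)
| Branch (k : nat) (t0 t1 : strategy).

(** Under exp (s ad b_i), f (b_k) changes by s times a nonzero multiple of f (b_m), with no second
    order term; so it can be given any value. *)
Definition moves_to (Z NZ : seq nat) (i k m : nat) : bool :=
  [&& (i < 53)%N, (k < 53)%N, ad_cube_zero i, m \in NZ, dead Z (second_comb i k) &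
      if live Z (tab i k) is [:: (m', z)] then (m' == m) && (z != 0) else false].

Definition eliminates_at (Z NZ done : seq nat) (i j : nat) : bool :=
  [&& (i < 53)%N, (j < 53)%N,
      all (fun i' => [|| i' == i, i' \in done | dead Z (tab i' j)]) (iota 0 53) &
      if live Z (tab i j) is [:: (m, z)] then (m \in NZ) && (z != 0) else false].

Fixpoint eliminates (Z NZ done : seq nat) (l : seq (nat * nat)) : seq nat :=
  if l is p :: l' then
    if eliminates_at Z NZ done p.1 p.2 then eliminates Z NZ (p.1 :: done) l' else done
  else done.

(** The other indices l give no condition: there [f [b_i, b_l] = 0] for all i in [J]. *)
Definition equations (Z : seq nat) (J : seq nat) : seq nat :=
  [seq l <- iota 0 53 | ~~ all (fun i => dead Z (tab i l)) J].

Definition grading (d : seq int) (i : nat) : int := dot d (rt i).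

Definition graded_check (w : nat -> int) : bool :=
  let ws := [seq w i | i <- iota 0 53] in
  all (fun i => all (fun j => all (fun p => ws`_p.1 == ws`_i + ws`_j) (tab i j)) (iota 0 53))
    (iota 0 53).

Definition leaf_check (Z NZ : seq nat) d elim J : bool :=
  let w := grading d in
  let done := eliminates Z NZ [::] elim in
  [&& graded_check w, all (fun i => (0 <= w i) || (i \in done)) (iota 0 53),
      uniq J, all (fun i => (i < 53)%N && (1 <= w i)) J &
      (size (equations Z J) < size J)%N].

Definition after (Z : seq nat) (i : nat) (s : seq nat) : seq nat :=
  [seq j <- s | preserved Z i j].

(** [Goto m] appeals to a state already refuted whose conditions are all among the present ones. *)
Fixpoint wins (known : seq (seq nat * seq nat)) (Z NZ : seq nat) (t : strategy) : bool :=
  match t with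
  | Leaf d elim J => leaf_check Z NZ d elim J
  | Goto m => let s := nth ([::], [::]) known m in
      [&& (m < size known)%N, all [in Z] s.1 & all [in NZ] s.2]
  | Clear i k t' =>
      has (fun m => moves_to Z NZ i k m) NZ
      && wins known (k :: after Z i Z) (after Z i NZ) t'
  | Swap i k j t' =>
      [&& k \in Z, moves_to Z NZ i k j & wins known (after Z i Z) (k :: after Z i NZ) t']
  | Branch k t0 t1 => [&& wins known (k :: Z) NZ t0 & wins known Z (k :: NZ) t1]
  end.

(* The Levi factor of p is gl(V) x sl(W) with dim V = 5 and dim W = 2, and the
   nilradical is (L^2 V (x) W) + L^4 V.  In terms of bases v_1, ..., v_5 and
   w_+, w_- : [E i j] is the index of the matrix unit v_j |-> v_i, [F12] and [F21]
   those of w_- |-> w_+ and w_+ |-> w_-, [Xp i j] and [Xm i j] (i < j) those of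
   v_i ^ v_j (x) w_+ and v_i ^ v_j (x) w_-, and [Y i] that of the product of the
   v_j, j <> i. *)
Definition simple_root (k : nat) : weight := [seq (k == j)%:Z | j <- iota 0 6].
Definition gl_root (i j : nat) : weight :=
  let chain a c := foldr vadd (nseq 6 0)
    [seq simple_root k | k <- take (c - a) (drop a.-1 [:: 0; 2; 3; 1]%N)] in
  if (i <= j)%N then chain i j else vopp (chain j i).
Definition Xm_weight (i j : nat) : weight :=
  vadd (simple_root 4) (vadd (gl_root i 4) (gl_root j 5)).
Definition Xp_weight (i j : nat) : weight := vadd (Xm_weight i j) (simple_root 5).
Definition Y_weight (i : nat) : weight :=
  vadd (vadd (Xm_weight 1 2) (Xp_weight 3 4)) (gl_root 5 i).

Definition E (i j : nat) : nat := index (gl_root i j) e6_roots.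
Definition Xm (i j : nat) : nat := index (Xm_weight i j) e6_roots.
Definition Xp (i j : nat) : nat := index (Xp_weight i j) e6_roots.
Definition Y (i : nat) : nat := index (Y_weight i) e6_roots.
Definition F12 : nat := index (simple_root 5) e6_roots.
Definition F21 : nat := index (vopp (simple_root 5)) e6_roots.

(** * Normal forms of the linear form *)

Definition clears (l : seq (nat * nat)) (t : strategy) : strategy :=
  foldr (fun p => Clear p.1 p.2) t l.

Definition state : Type := seq nat * seq nat.

Fixpoint all_win (known : seq state) (l : seq (state * strategy)) : bool :=
  if l is (s, t) :: l' then wins known s.1 s.2 t && all_win (rcons known s) l' else true.

(** With all these zeros, [f] can be nonzero only at [Y 1] on L^4 V, at [Xp 1 4] and [Xm 1 5] on v_1
    ^ V (x) W, and at [Xp 4 5] and [Xm 4 5] on the rest of L^2 V (x) W. *)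
Definition Y_zeros : seq nat := [:: Y 2; Y 3; Y 4; Y 5].
Definition X1_zeros : seq nat := [:: Xp 1 2; Xp 1 3; Xm 1 2; Xm 1 3; Xp 1 5; Xm 1 4].
Definition X_zeros : seq nat :=
  [:: Xm 2 3; Xp 2 3; Xm 2 4; Xp 2 4; Xm 2 5; Xp 2 5; Xm 3 4; Xp 3 4; Xm 3 5; Xp 3 5].

(** The generic case: 25 unknowns satisfy at most 24 equations. *)
Definition gamma_strategy : strategy :=
  Leaf [:: 2; 1; - 1; 2; 2; - 1]
    [:: (Xp 4 5, Xm 2 3); (E 5 3, Xm 1 3); (E 5 2, Xm 1 2); (E 4 3, Xp 1 3);
        (E 4 2, Xp 1 2); (E 2 1, Y 2); (E 3 1, Y 3); (E 4 1, Y 4); (E 5 1, Y 5);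
        (E 5 4, E 1 5); (F12, Xm 1 4); (E 2 3, E 3 5)]
    ([:: E 1 2; E 1 4; E 1 5; E 2 5; E 3 2; E 3 4; E 3 5; E 4 5; F21;
         Xm 1 2; Xm 1 3; Xm 1 4; Xm 1 5; Xm 2 3; Xm 3 5;
         Xp 1 2; Xp 1 3; Xp 1 4; Xp 2 3; Xp 3 4] ++ Y 1 :: Y_zeros).

(** Cases on the vector in the plane, with coordinates at [E 2 5] and [E 3 5]. *)
Definition kappa_strategy : strategy :=
  let t := Clear (E 2 3) (E 3 5) (Goto 0) in
  Branch (E 2 5)
    (Branch (E 3 5)
      (Leaf [:: 1; 0; 0; 1; 1; 0]
        [:: (E 5 3, Xm 1 3); (E 5 2, Xm 1 2); (E 4 3, Xp 1 3); (E 4 2, Xp 1 2);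
            (E 2 1, Y 2); (E 3 1, Y 3); (E 4 1, Y 4); (E 5 1, Y 5)]
        [:: E 1 5; E 2 5; E 3 5; Xm 1 2; Xm 1 3; Xm 2 3; Xp 1 2; Xp 1 3; Y 4])
      (Swap (E 3 2) (E 2 5) (E 3 5) t))
    t.

(** Brackets into [Y 1] clear L^2 V (x) W away from v_1; then come the cases on the linear form on
    the image of phi, with coordinates at [E 1 4] and [E 1 5]. [F12] and [F21] restore the zeros of
    phi disturbed by [E 5 4] and [E 4 5]. *)
Definition phi_strategy : strategy :=
  let t := clears [:: (E 5 4, E 1 5); (F12, Xm 1 4)] (Goto 1) in
  clears [:: (Xm 4 5, Xp 2 3); (Xp 4 5, Xm 2 3); (Xm 3 5, Xp 2 4); (Xp 3 5, Xm 2 4);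
             (Xm 3 4, Xp 2 5); (Xp 3 4, Xm 2 5); (Xm 2 5, Xp 3 4); (Xp 2 5, Xm 3 4);
             (Xm 2 4, Xp 3 5); (Xp 2 4, Xm 3 5)]
  (Branch (E 1 4)
    (Branch (E 1 5)
      (Leaf [:: 1; 0; 0; 0; 1; 0] [:: (E 2 1, Y 2); (E 3 1, Y 3); (E 4 1, Y 4); (E 5 1, Y 5)]
        [:: E 1 4; E 1 5; Xm 1 2; Xm 1 3; Xm 2 3; Xp 1 2; Xp 1 3; Xp 2 3; Y 2; Y 3; Y 4])
      (Swap (E 4 5) (E 1 4) (E 1 5) (Clear F21 (Xp 1 5) t)))
    t).

(** One row of phi is reduced to [Xp 1 4]; either the other row becomes zero and phi has rank 1, or
    it is reduced to [Xm 1 5]. *)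
Definition rank_strategy : strategy :=
  let t := clears [:: (E 5 2, Xm 1 2); (E 5 3, Xm 1 3)] (Goto 2) in
  clears [:: (E 4 2, Xp 1 2); (E 4 3, Xp 1 3); (E 4 5, Xp 1 5); (F12, Xm 1 4)]
  (Branch (Xm 1 5)
    (Branch (Xm 1 2)
      (Branch (Xm 1 3)
        (Leaf [:: 0; 0; 0; 0; 1; 0] [::] [:: Xm 1 2; Xm 1 3; Xm 1 5; Y 2; Y 3])
        (Swap (E 3 5) (Xm 1 5) (Xm 1 3) t))
      (Swap (E 2 5) (Xm 1 5) (Xm 1 2) t))
    t).

(** A nonzero entry of phi is sought and brought to [Xp 1 4]; the leaf is the case where phi is
    zero. *)
Definition Y1_strategy : strategy :=
  let pivot k t t0 := Branch k t0 t in
  clears [:: (E 2 1, Y 2); (E 3 1, Y 3); (E 4 1, Y 4); (E 5 1, Y 5)]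
  (pivot (Xp 1 4) (Goto 3)
  (pivot (Xp 1 2) (Swap (E 2 4) (Xp 1 4) (Xp 1 2) (Goto 3))
  (pivot (Xp 1 3) (Swap (E 3 4) (Xp 1 4) (Xp 1 3) (Goto 3))
  (pivot (Xp 1 5) (Swap (E 5 4) (Xp 1 4) (Xp 1 5) (Goto 3))
  (pivot (Xm 1 4) (Swap F21 (Xp 1 4) (Xm 1 4) (Goto 3))
  (pivot (Xm 1 2) (Swap (E 2 4) (Xm 1 4) (Xm 1 2) (Swap F21 (Xp 1 4) (Xm 1 4) (Goto 3)))
  (pivot (Xm 1 3) (Swap (E 3 4) (Xm 1 4) (Xm 1 3) (Swap F21 (Xp 1 4) (Xm 1 4) (Goto 3)))
  (pivot (Xm 1 5) (Swap (E 5 4) (Xm 1 4) (Xm 1 5) (Swap F21 (Xp 1 4) (Xm 1 4) (Goto 3)))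
    (Leaf [:: 0; 0; 0; 0; 1; 0] [::] [:: Xm 1 3; Xm 1 4; Xm 1 5; Xp 1 4; Xp 1 5]))))))))).

Definition start_strategy : strategy :=
  Branch (Y 1)
    (Branch (Y 2)
      (Branch (Y 3)
        (Branch (Y 4)
          (Branch (Y 5)
            (Leaf [:: 0; 0; 0; 0; 1; 0] [::] [:: Y 1])
            (Swap (E 1 5) (Y 1) (Y 5) (Goto 4)))
          (Swap (E 1 4) (Y 1) (Y 4) (Goto 4)))
        (Swap (E 1 3) (Y 1) (Y 3) (Goto 4)))
      (Swap (E 1 2) (Y 1) (Y 2) (Goto 4)))
    (Goto 4).

(** From the most normalized state to the one without conditions, each reducing to earlier ones. *)
Definition normal_forms : seq (state * strategy) :=
  [:: ((E 1 5 :: E 3 5 :: X_zeros ++ X1_zeros ++ Y_zeros,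
        [:: E 1 4; E 2 5; Xp 1 4; Xm 1 5; Y 1]), gamma_strategy);
      ((E 1 5 :: X_zeros ++ X1_zeros ++ Y_zeros, [:: E 1 4; Xp 1 4; Xm 1 5; Y 1]),
        kappa_strategy);
      ((X1_zeros ++ Y_zeros, [:: Xp 1 4; Xm 1 5; Y 1]), phi_strategy);
      ((Y_zeros, [:: Xp 1 4; Y 1]), rank_strategy);
      (([::], [:: Y 1]), Y1_strategy);
      (([::], [::]), start_strategy)].

Lemma normal_forms_win : all_win [::] normal_forms.
Proof. by vm_compute. Qed.

Lemma graded_checkP w : graded_check w -> graded w.
Proof.
rewrite /graded_check => H i j p lti ltj pin.
have /allP/(_ p pin) := all2_iota H (i := i) (j := j) lti ltj.
have ltp : (p.1 < 53)%N := allP (tab_closed lti ltj) _ pin.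
by rewrite !(nth_map 0%N) ?size_iota // !nth_iota // => /eqP.
Qed.

(** * Soundness of the certificates *)

Section Soundness.
Variables (K : numFieldType) (L : lieAlgType K) (f : 'Hom(L, K^o)).

Definition coords (b : nat -> L) (i : nat) : K^o := f (b i).
Definition satisfies (b : nat -> L) (Z NZ : seq nat) : Prop :=
  {in Z, forall i, coords b i = 0} /\ {in NZ, forall i, coords b i != 0}.
Definition refutes (Z NZ : seq nat) : Prop :=
  forall b, e6_frame b -> satisfies b Z NZ -> ~ reductive_type f.

Lemma f_ev b s : f (ev b s) = ev (coords b) s.
Proof. by rewrite /ev linear_sum; apply: eq_bigr => p _; rewrite linearZ. Qed.

Lemma ev_dead b Z NZ s : satisfies b Z NZ -> dead Z s -> ev (coords b) s = 0.
Proof.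
case=> Z0 _ /allP sZ; rewrite /ev big_seq big1 // => p /sZ /Z0 ->; exact: scaler0.
Qed.

Lemma ev_live b Z NZ s : satisfies b Z NZ -> ev (coords b) s = ev (coords b) (live Z s).
Proof.
case=> Z0 _; rewrite /ev /live big_filter [LHS](bigID (fun p => p.1 \notin Z)) /=.
rewrite [X in _ + X]big1 ?addr0 // => p; rewrite negbK => /Z0 ->; exact: scaler0.
Qed.

Lemma move_frame b i s : e6_frame b -> (i < 53)%N -> ad_cube_zero i ->
  exists2 b', e6_frame b' & forall j, (j < 53)%N ->
    coords b' j = coords b j + s * ev (coords b) (tab i j)
                  + 2%:R^-1 * (s * (s * ev (coords b) (second_comb i j))).
Proof.
move=> fb lti cube; have [_ tabE] := fb.
have tab2 j : (j < 53)%N -> lie (b i) (ev b (tab i j)) = ev b (second_comb i j).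
  move=> ltj; apply: ev_tab_comb => p pin; apply: tabE => //.
  exact: allP (tab_closed lti ltj) _ pin.
have tab2_closed j : (j < 53)%N -> small_comb 53 (second_comb i j).
  move=> ltj; apply/allP => _ /flatten_mapP[p pin /mapP[q qin ->]] /=.
  exact: (allP (tab_closed lti (allP (tab_closed lti ltj) _ pin)) _ qin).
have nb j : (j < 53)%N -> lie (s *: b i) (b j) = s *: ev b (tab i j).
  by move=> ltj; rewrite lieZl tabE.
have nnb j : (j < 53)%N -> lie (s *: b i) (lie (s *: b i) (b j)) =
    s *: (s *: ev b (second_comb i j)).
  by move=> ltj; rewrite nb // linearZ /= lieZl tab2.
have n3 x : lie (s *: b i) (lie (s *: b i) (lie (s *: b i) x)) = 0.
  have [z ->] := frame_coord x fb; rewrite !linear_sum big1 // => j _.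
  rewrite !linearZ /= nnb // !linearZ /= lieZl (ev_tab_comb (i := i)); last first.
    by move=> p pin; apply: tabE => //; exact: allP (tab2_closed _ (ltn_ord j)) _ pin.
  by rewrite (ceqP _ (allP_iota cube (leq0n _) (ltn_ord j))) ev_nil !scaler0.
exists (fun j => exp2 (s *: b i) (b j)); first exact: exp2_frame.
move=> j ltj; rewrite /coords exp2E nnb // nb //.
by rewrite !linearD !linearZ /= !f_ev.
Qed.

Lemma move_after b b' i s Z NZ : satisfies b Z NZ ->
    (forall j, (j < 53)%N -> coords b' j = coords b j + s * ev (coords b) (tab i j)
                  + 2%:R^-1 * (s * (s * ev (coords b) (second_comb i j)))) ->
  satisfies b' (after Z i Z) (after Z i NZ).
Proof.
move=> sat b'E; have keep j : preserved Z i j -> coords b' j = coords b j.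
  case/and3P=> ltj d1 d2; rewrite b'E // (ev_dead sat d1) (ev_dead sat d2).
  by rewrite !mulr0 !addr0.
have [Z0 NZ0] := sat.
by split=> j; rewrite mem_filter => /andP[/keep -> jin]; [exact: Z0 | exact: NZ0].
Qed.

(** The scalar [s] stays free: one choice cancels the coordinate at [k], and [s = 1] makes it
    nonzero if it was zero. *)
Lemma clear_step b i k m Z NZ : satisfies b Z NZ -> moves_to Z NZ i k m -> e6_frame b ->
  exists2 z : K, z != 0 & coords b m != 0 /\ forall s : K,
  exists2 b', e6_frame b' & satisfies b' (after Z i Z) (after Z i NZ) /\
    coords b' k = coords b k + s * (z * coords b m).
Proof.
move=> sat /and5P[lti ltk cube min /andP[d2]].
case lE: (live Z (tab i k)) => [|[m' z] [|? ?]] // /andP[/eqP mE z0] fb.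
exists z%:~R; first by rewrite intr_eq0.
split; first by case: sat => _; apply.
move=> s; have [b' fb' b'E] := move_frame s fb lti cube.
exists b' => //; split; first exact: move_after sat b'E.
rewrite b'E // (ev_live _ sat) lE (ev_dead sat d2) !mulr0 addr0.
by rewrite ev_cons ev_nil addr0 /= mE.
Qed.

Lemma eliminatesP b Z NZ (z : nat -> K) (done : seq nat) l : e6_frame b -> satisfies b Z NZ ->
    \sum_(i < 53) z i *: b i \in stab f ->
    (forall i, i \in done -> z i = 0) ->
  forall i, i \in eliminates Z NZ done l -> z i = 0.
Proof.
move=> fb sat /stabP zS; elim: l done => [//|[i j] l IHl] done done0.
rewrite [eliminates _ _ _ _]/=.
case: ifP => // /and4P[lti ltj /allP_iota others].
have [_ tabE] := fb.
case lE: (live Z (tab i j)) => [|[m c] [|? ?]] // /andP[min c0].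
apply: IHl => k; rewrite inE => /predU1P[->|]; last exact: done0.
have := zS (b j); rewrite lie_suml linear_sum (bigD1 (Ordinal lti)) //=.
rewrite big1 => [|i' ni']; last first.
  rewrite lieZl linearZ /= tabE // f_ev.
  have /or3P[/eqP e|i'd|d] := others i' (leq0n _) (ltn_ord i').
  - by case/eqP: ni'; apply: val_inj.
  - by rewrite done0 // scale0r.
  by rewrite (ev_dead sat d) scaler0.
rewrite addr0 lieZl linearZ /= tabE // f_ev (ev_live _ sat) lE ev_cons ev_nil addr0 /=.
case: sat => _ /(_ m min) nm /eqP.
by rewrite !scaler_eq0 intr_eq0 (negPf c0) (negPf nm) !orbF => /eqP.
Qed.

(** A nonzero kernel vector of [M], which has fewer columns than rows, yields a nonzero element of
    the stabilizer in positive degree, while [elim] removes the components of negative degree. *)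
Lemma leafP Z NZ d elim J : leaf_check Z NZ d elim J -> refutes Z NZ.
Proof.
case/and5P=> /graded_checkP gw /allP_iota neg uJ /allP J1 szE b fb sat.
have [_ tabE] := fb; set E := equations Z J in szE.
pose M : 'M[K]_(size J, size E) :=
  \matrix_(r, c) ev (coords b) (tab (nth 0%N J r) (nth 0%N E c)).
have [v vM nzv] : exists2 v : 'rV[K]_(size J), v *m M = 0 & v != 0.
  have nzk : kermx M != 0.
    rewrite -mxrank_eq0 mxrank_ker subn_eq0 -ltnNge.
    exact: leq_ltn_trans (rank_leq_col M) szE.
  exists (nz_row (kermx M)); last by rewrite nz_row_eq0.
  by apply/sub_kermxP; apply: nz_row_sub.
pose x := \sum_(r < size J) v 0 r *: b (nth 0%N J r).
have Jlt r : (r < size J)%N -> (nth 0%N J r < 53)%N /\ 1 <= grading d (nth 0%N J r).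
  by move=> ltr; apply/andP/J1/mem_nth.
have xS : x \in stab f.
  apply/stabP => y; have [z ->] := frame_coord y fb.
  rewrite !linear_sum big1 // => l _; rewrite !linearZ /=.
  suff -> : f (lie x (b l)) = 0 by rewrite scaler0.
  rewrite lie_suml linear_sum.
  transitivity (\sum_(r < size J) v 0 r * ev (coords b) (tab (nth 0%N J r) l)).
    apply: eq_bigr => r _; have [ltr _] := Jlt r (ltn_ord r).
    by rewrite lieZl linearZ /= tabE // f_ev.
  have [lE|nlE] := boolP (val l \in E).
    have lt : (index (val l) E < size E)%N by rewrite index_mem.
    have := congr1 (fun A : 'rV_(size E) => A 0 (Ordinal lt)) vM.
    rewrite !mxE => vM0; rewrite -[RHS]vM0; apply: eq_bigr => r _.
    by rewrite mxE /= nth_index.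
  move: nlE; rewrite mem_filter mem_iota /= ltn_ord andbT negbK => /allP dJ.
  rewrite big1 // => r _; rewrite (ev_dead sat) ?mulr0 //; apply/dJ/mem_nth/ltn_ord.
apply: (graded_not_reductive_type fb gw _ xS).
- apply/subvP => y yS; have [z yE] := frame_coord y fb; rewrite yE.
  rewrite memv_suml // => i _; have [le0|lt0] := boolP (0 <= grading d i).
    by rewrite memvZ // filtration_mem.
  have := neg i (leq0n _) (ltn_ord i); rewrite (negPf lt0) => /= ie.
  have -> : z i = 0.
    apply: (@eliminatesP b Z NZ z [::] elim) ie => //; by rewrite -yE.
  by rewrite scale0r mem0v.
- rewrite memv_suml // => r _; have [ltr ge1] := Jlt r (ltn_ord r).
  by rewrite memvZ // filtration_mem.
apply: contra_neq nzv => x0; apply/rowP => r; rewrite mxE.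
have [ltr _] := Jlt r (ltn_ord r).
(* Coefficients are collected by basis index; as [J] has no repetition, each sum has at most one
   term. *)
pose z i := \sum_(s < size J | nth 0%N J s == i) v 0 s.
have zE : \sum_(i < 53) z i *: b i = 0.
  rewrite -[RHS]x0 /x.
  rewrite (partition_big (fun s : 'I_(size J) => Ordinal (Jlt s (ltn_ord s)).1) xpredT) //=.
  apply: eq_bigr => i _; rewrite scaler_suml; apply: eq_big => // s /eqP <- //.
have := frame_sum0 fb zE ltr; rewrite /z (big_pred1 r) // => s /=.
by rewrite nth_uniq ?ltn_ord.
Qed.

Lemma winsP known Z NZ t :
    (forall m, (m < size known)%N -> let s := nth ([::], [::]) known m in refutes s.1 s.2) ->
  wins known Z NZ t -> refutes Z NZ.
Proof.
move=> knownP; elim: t Z NZ => [d l J|m|i k t IHt|i k j t IHt|k t0 IH0 t1 IH1] Z NZ /=.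
- exact: leafP.
- move=> /and3P[ltm /allP Zm /allP NZm] b fb [Z0 NZ0].
  apply: (knownP m ltm b fb); split=> i; [move/Zm; exact: Z0 | move/NZm; exact: NZ0].
- move=> /andP[/hasP[m _ mv] /IHt win] b fb sat.
  have [z z0 [m0 mvP]] := clear_step sat mv fb.
  have [b' fb' [[Z' NZ'] b'k]] := mvP (- coords b k / (z * coords b m)).
  apply: (win b' fb'); split=> // r; rewrite inE => /predU1P[->|]; last exact: Z'.
  by rewrite b'k divfK ?subrr // mulf_neq0.
- move=> /and3P[kZ mv /IHt win] b fb sat.
  have [z z0 [m0 mvP]] := clear_step sat mv fb.
  have [b' fb' [[Z' NZ'] b'k]] := mvP 1.
  apply: (win b' fb'); split=> // r; rewrite inE => /predU1P[->|]; last exact: NZ'.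
  by rewrite b'k mul1r; case: sat => /(_ k kZ) -> _; rewrite add0r mulf_neq0.
move=> /andP[/IH0 win0 /IH1 win1] b fb [Z0 NZ0].
have [bk0|bk] := eqVneq (coords b k) 0.
  by apply: (win0 b fb); split=> // r; rewrite inE => /predU1P[->|/Z0].
by apply: (win1 b fb); split=> // r; rewrite inE => /predU1P[->|/NZ0].
Qed.

Lemma all_winP known l :
    (forall m, (m < size known)%N -> let s := nth ([::], [::]) known m in refutes s.1 s.2) ->
    all_win known l ->
  forall s, s \in [seq p.1 | p <- l] -> refutes s.1 s.2.
Proof.
elim: l known => [|[s t] l IHl] known //= knownP /andP[win wins] s'.
have sP := winsP knownP win.
rewrite inE => /predU1P[-> //|]; apply: IHl wins s' => m.
rewrite size_rcons nth_rcons ltnS leq_eqVlt => /predU1P[->|ltm].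
  by rewrite ltnn eqxx.
by rewrite ltm; apply: knownP.
Qed.

Lemma frame_not_reductive_type (b : nat -> L) : e6_frame b -> ~ reductive_type f.
Proof.
move=> fb; have start : (([::], [::]) : state) \in [seq p.1 | p <- normal_forms].
  by rewrite !inE eqxx !orbT.
have known m : (m < 0)%N -> let s := nth ([::], [::]) [::] m in refutes s.1 s.2 by [].
have Hs := all_winP (known := [::]) known normal_forms_win start.
by apply: (Hs b fb); split.
Qed.

End Soundness.

Local Open Scope complex_scope.

Theorem theorem4p6 (R : realType) (g : lieAlgType R[i])
    (np h nm : {vspace g}) (alpha : 'I_6 -> 'Hom(subvs_of h, R[i]^o))
    (g_simple : simple g)
    (g_triangular : triangular_decomposition np nm alpha)
    (g_E6 : has_cartan_matrix alpha E6_cartan) :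
  ~ quasi_reductive
      (subalg_type (std_parabolic np alpha
        [set i : 'I_6 | bourbaki i \in [:: 1; 2; 3; 4; 6]%N])).
Proof.
case=> f; have [b fb] := @parabolic_frame R[i] g np h nm alpha g_triangular g_E6.
exact: frame_not_reductive_type fb.
Qed.
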